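(* Let $\kappa$ be a positive integer and let $(G_m)$ be a sequence of connected regular graphs of orders $n_m$, degrees $d_m\to\infty$, and edge-connectivity at least $\kappa$. Then $$\liminf_{m\to\infty} n_m^2\lambda(G_m)\ge 8\kappa,$$ and, for each $\kappa$, the constant $8\kappa$ is best possible (it cannot be replaced by a larger one). Furthermore, $n_m^2\lambda(G_m)\to 8\kappa$ if and only if, for all sufficiently large $m$, there is an edge cut of $G_m$ of size $\kappa$ separating $V(G_m)$ into two sets of $d_m+o(d_m)$ vertices each.
   Context: All graphs are finite, simple and undirected. For a connected $d$-regular graph $G$, $\lambda(G)=\mu(G)/d$ is the spectral gap of simple random walk, where $\mu(G)$ is the second smallest eigenvalue of the Laplacian of $G$. An edge cut consists of all edges between a nonempty proper vertex set and its complement; the edge-connectivity is the minimum size of an edge cut. *)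

(* Defs.v *)
From mathcomp Require Import all_boot all_order all_algebra.

Set Implicit Arguments.
Unset Strict Implicit.
Unset Printing Implicit Defensive.

Import Order.TTheory GRing.Theory Num.Theory.

Record sgraph := SGraph {
  vertex :> finType;
  adj : rel vertex;
  adj_sym : symmetric adj;
  adj_irrefl : irreflexive adj }.

Definition connected_graph (G : sgraph) : bool :=
  (0 < #|G|)%N && [forall x : G, [forall y : G, connect (@adj G) x y]].

Definition degree (G : sgraph) (x : G) : nat := #|[set y | adj x y]|.

Definition regular_graph (G : sgraph) (d : nat) : bool :=
  [forall x : G, degree x == d].

Definition edges (G : sgraph) : {set {set G}} :=
  [set [set x; y] | x in [set: G], y in [set: G] & adj x y].

Definition proper_vertex_set (G : sgraph) (S : {set G}) : bool :=
  (S != set0) && (S != [set: G]).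

Definition edge_cut (G : sgraph) (S : {set G}) : {set {set G}} :=
  [set [set x; y] | x in S, y in ~: S & adj x y].

(* The neutral value [#|edges G|] bounds the size of every edge cut, so it does
   not affect the minimum when an edge cut exists. A one-vertex graph has no
   edge cut and gets the conventional edge-connectivity 0. *)
Definition edge_connectivity (G : sgraph) : nat :=
  \big[minn/#|edges G|]_(S : {set G} | proper_vertex_set S) #|edge_cut S|.

(* Loaded here because classical_sets shadows the finset names and notations
   used above. *)
From mathcomp Require Import all_classical all_reals all_analysis.
Import numFieldNormedType.Exports.
Local Open Scope ring_scope.

Definition laplacian (R : realType) (G : sgraph) : 'M[R]_#|G| :=
  \matrix_(i, j) ((degree (enum_val i))%:R *+ (i == j)
                  - (adj (enum_val i) (enum_val j))%:R).

(* Eigenvalues in nondecreasing order, repeated according to multiplicity. The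
   default [::] is only used when the characteristic polynomial does not split
   over R, which does not happen for symmetric matrices. *)
Definition eigenvalues (R : realType) (n : nat) (A : 'M[R]_n) : seq R :=
  sort <=%R
    (xget [::] [set s | char_poly A = \prod_(x <- s) ('X - x%:P)]%classic).

(* The second smallest eigenvalue has index 1, as sequences start at 0. *)
Definition mu (R : realType) (G : sgraph) : R :=
  (eigenvalues (laplacian R G))`_1.

Definition spectral_gap (R : realType) (G : sgraph) (d : nat) : R :=
  mu R G / d%:R.

Definition scaled_gap (R : realType) (G : nat -> sgraph) (d : nat -> nat)
    (m : nat) : R :=
  #|G m|%:R ^+ 2 * spectral_gap R (G m) (d m).

Definition admissible (k : nat) (G : nat -> sgraph) (d : nat -> nat) : Prop :=
  (d m @[m --> \oo] --> \oo)%classic /\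
  forall m, [/\ connected_graph (G m), regular_graph (G m) (d m)
              & (k <= edge_connectivity (G m))%N].

(* Main.v *)
(* Let f be an eigenfunction for mu, sorted along the vertices, and let M_i be
   minus its sum over the first i vertices. The flux of the gradient of f
   through the i-th prefix is mu * M_i, and the sum of f^2 is the sum of the
   M_i times the i-th gap of f. In a d-regular graph a vertex set whose cut has
   fewer than d edges has more than d vertices, so the prefixes with cuts below
   d/2 ("low" cuts) are at mutual distance at least d; at a low cut with c edges
   the gap is at most mu * M_i / c. The other gaps are negligible: a small flux
   forces every vertex to have at least d/2 vertices within 4 mu N / d of its
   value, where N bounds all M_i, and double counting then bounds the total
   length of these gaps. Up to a factor 1 + O(1/d) this leaves
   sum f^2 <= mu * sum_low M_i^2 / c_i, while sum f^2 is the Dirichlet energy of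
   the polygon i |-> M_i, which vanishes at 0 and n. A discrete Hardy inequality
   with a polynomial supersolution gives n^2 mu / d >= 8.08 k (1 - o(1)) when
   there are at least two low cuts; with a single low cut S the bound is
   n^3 c / (d |S| |~S|), whose minimum 8k is reached exactly when c = k and both
   sides have d + o(d) vertices. The converse is the test function
   1_S - |S|/n. *)
Require Import Defs.
From mathcomp Require Import all_boot all_order all_algebra.
From mathcomp Require Import zify.

Set Implicit Arguments.
Unset Strict Implicit.
Unset Printing Implicit Defensive.

(** * Edge cuts *)

(** A crossing edge determines which of its ends lies in [S], so unordered crossing edges correspond
    bijectively to ordered pairs leaving [S]. *)
Lemma card_edge_cut (G : sgraph) (S : {set G}) :
  #|edge_cut S| = \sum_(x in S) #|[set y | adj x y & y \notin S]|.
Proof.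
pose E := [set p : G * G | [&& p.1 \in S, p.2 \notin S & adj p.1 p.2]].
have -> : edge_cut S = [set [set p.1; p.2] | p in E].
  apply/setP => e; apply/imset2P/imsetP => [[x y xS]|[[x y]]].
    by rewrite !inE => /andP[yS xy] ->; exists (x, y); rewrite // inE xS yS.
  rewrite inE /= => /and3P[xS yS xy] ->; exists x y => //.
  by rewrite !inE yS.
rewrite card_in_imset; last first.
  move=> [x y] [x' y']; rewrite !inE /= => /and3P[xS yS _] /and3P[x'S y'S _] /setP e.
  have := e x; rewrite !inE eqxx /= => /esym /orP[/eqP xx|/eqP xy]; last first.
    by rewrite -xy xS in y'S.
  have := e y; rewrite !inE eqxx orbT => /esym /orP[/eqP yx|/eqP yy]; last first.
    by rewrite xx yy.
  by rewrite yx x'S in yS.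
rewrite -sum1_card; under eq_bigl do rewrite inE.
rewrite -(pair_big_dep (mem S) (fun x y => (y \notin S) && adj x y) (fun _ _ =>
  1%N)) /=.
by apply: eq_bigr => x xS; rewrite -sum1_card; apply: eq_bigl => y; rewrite inE andbC.
Qed.

Lemma card_edge_cutE (G : sgraph) (S : {set G}) :
  #|edge_cut S| = \sum_(x in S) \sum_(y | y \notin S) adj x y.
Proof.
rewrite card_edge_cut; apply: eq_bigr => x _.
rewrite -sum1_card -big_mkcondr /=; apply: eq_bigl => y.
by rewrite inE andbC.
Qed.

Lemma card_edge_cutC (G : sgraph) (S : {set G}) : #|edge_cut (~: S)| = #|edge_cut S|.
Proof.
rewrite !card_edge_cutE (eq_bigl (fun x => x \notin S)) => [|x]; last by rewrite inE.
rewrite exchange_big /=; apply: eq_big => [x|x _]; first by rewrite !inE negbK.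
by apply: eq_bigr => y _; rewrite adj_sym.
Qed.

Lemma regular_degree (G : sgraph) (d : nat) :
  regular_graph G d -> forall x : G, \sum_y adj x y = d.
Proof.
move=> /forallP reg x; rewrite -(eqP (reg x)) /degree -sum1_card -big_mkcond /=.
by apply: eq_bigl => y; rewrite inE.
Qed.

(** If s = |S| were at most d, each vertex of [S] would send at least d - s + 1 edges out, and s (d
    - s + 1) >= d whenever 1 <= s <= d. *)
Lemma regular_small_cut (G : sgraph) (d : nat) (S : {set G}) :
  regular_graph G d -> S != set0 -> #|edge_cut S| < d -> d < #|S|.
Proof.
move=> reg S0; apply: contraTT; rewrite -!leqNgt => Sd.
have Spos : 0 < #|S| by rewrite card_gt0.
have low x : x \in S -> d - #|S|.-1 <= \sum_(y | y \notin S) adj x y.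
  move=> xS; rewrite leq_subLR -(regular_degree reg x) (bigID (mem S)) /= leq_add2r.
  rewrite (bigD1 x) //= adj_irrefl add0n (cardsD1 x S) xS /= -sum1_card.
  rewrite (eq_bigl (fun y => y \in S :\ x)) => [|y]; last by rewrite !inE andbC.
  by apply: leq_sum => y _; case: adj.
apply: (@leq_trans (#|S| * (d - #|S|.-1))); last first.
  by rewrite card_edge_cutE -sum_nat_const; apply: leq_sum => x; apply: low.
by nia.
Qed.

Lemma card_edge_cut_pairs (G : sgraph) (S : {set G}) :
  #|edge_cut S| = \sum_x \sum_y [&& x \in S, y \notin S & adj x y].
Proof.
rewrite card_edge_cutE big_mkcond; apply: eq_bigr => x _.
case: (x \in S) => /=; last by rewrite big1.
by rewrite big_mkcond; apply: eq_bigr => y _; case: (y \in S).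
Qed.

(** An edge leaving the difference ends either in [S], crossing the cut of [S], or outside [T],
    crossing the cut of [T]. *)
Lemma card_edge_cutD (G : sgraph) (S T : {set G}) :
  #|edge_cut (T :\: S)| <= #|edge_cut S| + #|edge_cut T|.
Proof.
rewrite -[#|edge_cut S|]card_edge_cutC !card_edge_cut_pairs -big_split /=.
apply: leq_sum => x _; rewrite -big_split; apply: leq_sum => y _ /=.
by rewrite !inE; case: (x \in S); case: (y \in S); case: (x \in T); case: (y \in T);
  case: adj.
Qed.

Lemma edge_connectivity_le (G : sgraph) (S : {set G}) :
  proper_vertex_set S -> edge_connectivity G <= #|edge_cut S|.
Proof.
move=> PS; rewrite /edge_connectivity; have := mem_index_enum S.
elim: (index_enum _) => //= T r IH; rewrite inE big_cons => /predU1P[<-|/IH le].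
  by rewrite PS geq_minl.
by case: ifP => // _; rewrite geq_min le orbT.
Qed.

Lemma edge_connectivity_le_edges (G : sgraph) : edge_connectivity G <= #|edges G|.
Proof.
rewrite /edge_connectivity; elim: (index_enum _) => [|T r IH]; first by rewrite big_nil.
by rewrite big_cons; case: ifP => // _; rewrite geq_min IH orbT.
Qed.

Lemma le_edge_connectivity (G : sgraph) (k : nat) (S0 : {set G}) :
  proper_vertex_set S0 ->
  (forall S : {set G}, proper_vertex_set S -> k <= #|edge_cut S|) ->
  k <= edge_connectivity G.
Proof.
move=> P0 kle; apply: (big_ind (fun m => k <= m)) => [|x y kx ky|S PS]; last exact: kle.
  (* The neutral value of the minimum: the cut of [S0] has at least [k] edges, hence so has the
     graph. *)
  apply: leq_trans (kle _ P0) _; apply: subset_leq_card; apply/subsetP => e.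
  case/imset2P => x y _; rewrite inE => /andP[_ xy] ->.
  by apply/imset2P; exists x y; rewrite // !inE.
by rewrite leq_min kx.
Qed.

(** * Two dense blocks joined by k edges *)

(** The set reachable from a vertex has an empty cut, so it cannot be proper. *)
Lemma connected_of_cuts (G : sgraph) : 0 < #|G| ->
  (forall S : {set G}, proper_vertex_set S -> 0 < #|edge_cut S|) -> connected_graph G.
Proof.
move=> G0 cuts; rewrite /connected_graph G0; apply/forallP => x; apply/forallP => y.
apply/negPn/negP => xy; pose S := [set z | connect (@adj G) x z].
have : proper_vertex_set S.
  apply/andP; split; first by apply/set0Pn; exists x; rewrite inE connect0.
  by apply/eqP => /setP /(_ y); rewrite !inE (negbTE xy).
move=> /cuts; rewrite card_edge_cutE big1 // => u; rewrite inE => xu.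
rewrite big1 // => w; rewrite inE; case uw: (adj u w) => //.
by rewrite (connect_trans xu (connect1 uw)).
Qed.

Section Doubling.
Variables (T : finType) (C : rel T) (special : pred T).
Hypotheses (C_sym : symmetric C) (C_irr : irreflexive C).
Hypothesis C_deg : forall x, \sum_y C x y = (special x).+1.

Definition double_adj (p q : bool * T) : bool :=
  if p.1 == q.1 then (p.2 != q.2) && ~~ C p.2 q.2 else (p.2 == q.2) && special p.2.

Lemma double_adj_sym : symmetric double_adj.
Proof.
move=> [s x] [t y]; rewrite /double_adj /= (eq_sym t) (eq_sym y) C_sym.
by case: ifP => // _; case: eqP => // ->.
Qed.

Lemma double_adj_irrefl : irreflexive double_adj.
Proof. by move=> [s x]; rewrite /double_adj /= !eqxx. Qed.

(* Two copies of the complement of [C], joined along the special vertices. *)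
Definition double_graph : sgraph := SGraph double_adj_sym double_adj_irrefl.

Lemma sum_double (F : bool * T -> nat) (s : bool) :
  \sum_p F p = \sum_y F (s, y) + \sum_y F (~~ s, y).
Proof.
rewrite (eq_bigr (fun p => F (p.1, p.2))) => [|[] //].
rewrite -(pair_bigA _ (fun t y => F (t, y))) /= big_bool.
by case: s; rewrite // addnC.
Qed.

Lemma sum_complement (x : T) :
  \sum_y ((x != y) && ~~ C x y) + (special x).+2 = #|T|.
Proof.
rewrite -addn1 -C_deg -[1]/(true : nat) addnA -sum1_card.
have -> : (true : nat) = \sum_y (x == y).
  by rewrite (bigD1 x) //= eqxx big1 // => y /negbTE; rewrite eq_sym => ->.
rewrite -!big_split; apply: eq_bigr => y _ /=.
by case: eqVneq => [<-|]; rewrite ?C_irr //; case: C.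
Qed.

(** The degree of [x] in [C] is at most 2, so inside its copy [x] is joined to all but two vertices
    of [P] at worst. *)
Lemma sum_complement_ge (x : T) (P : pred T) : ~~ P x ->
  #|P| <= \sum_(y | P y) ((x != y) && ~~ C x y) + 2.
Proof.
move=> Px; have : \sum_(y | P y) C x y <= 2.
  apply: (@leq_trans (special x).+1); last by case: (special x).
  by rewrite -C_deg [leqRHS](bigID P) leq_addr.
rewrite -(leq_add2l (\sum_(y | P y) ((x != y) && ~~ C x y))); apply: leq_trans.
rewrite -big_split -sum1_card; apply: leq_sum => y Py /=.
case: eqVneq => [xy|_]; last by case: C.
by move: Py; rewrite -xy unfold_in (negbTE Px).
Qed.

(** A special vertex loses one more neighbour to [C] than the others do, and regains one across the
    link between the copies. *)
Lemma double_regular : regular_graph double_graph #|T|.-2.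
Proof.
apply/forallP => -[s x]; apply/eqP; rewrite /degree -sum1_card.
rewrite (eq_bigl (fun q => double_adj (s, x) q)) => [|q]; last by rewrite inE.
rewrite (eq_bigr (fun q => 1)) // big_mkcond (sum_double _ s).
rewrite (eq_bigr (fun y => ((x != y) && ~~ C x y : nat))) => [|y _]; last first.
  by rewrite /double_adj /= eqxx; case: (_ && _).
rewrite [X in _ + X](eq_bigr (fun y => ((x == y) && special x : nat))) => [|y _];
  last first.
  by rewrite /double_adj /=; case: s => /=; case: (_ && _).
have -> : \sum_y ((x == y) && special x) = special x.
  by rewrite (bigD1 x) //= eqxx big1 ?addn0 // => y /negbTE; rewrite eq_sym => ->.
by rewrite -(sum_complement x) !addnS.
Qed.

Definition block (s : bool) : {set double_graph} := [set p : bool * T | p.1 == s].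

Lemma card_block s : #|block s| = #|T|.
Proof.
rewrite -sum1_card big_mkcond (sum_double _ s) /= -sum1_card.
rewrite [X in _ + X]big1 ?addn0; last by move=> y _; rewrite inE /=; case: s.
by apply: eq_bigr => y _; rewrite inE /= eqxx.
Qed.

Lemma blockC s : ~: block s = block (~~ s).
Proof. by apply/setP => -[t x]; rewrite !inE /=; case: s; case: t. Qed.

Lemma card_block_cut s : #|edge_cut (block s)| = #|special|.
Proof.
rewrite card_edge_cut_pairs (sum_double _ s) /=.
rewrite [X in _ + X]big1 ?addn0; last first.
  by move=> y _; rewrite big1 // => q _; rewrite inE /=; case: s.
rewrite -sum1_card [in RHS]big_mkcond; apply: eq_bigr => x _.
rewrite (sum_double _ s) big1 ?add0n; last first.
  by move=> y _; rewrite !inE /= eqxx.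
rewrite (bigD1 x) //= big1 ?addn0; last first.
  move=> y /negbTE yx; rewrite /double_adj /= (eq_sym x) yx.
  by rewrite !inE /=; case: s.
by rewrite !inE /double_adj /= !eqxx /= unfold_in; case: s => /=; case: (special x).
Qed.

(** If [S] splits a copy into parts of sizes u and w, the cut has at least max(u, w) - 2 edges,
    hence at least |T| / 2 - 2. Otherwise [S] is a single copy, and its cut consists of the
    links. *)
Lemma double_cut_ge (S : {set double_graph}) : 2 * (#|special| + 2) <= #|T| ->
  proper_vertex_set S -> #|special| <= #|edge_cut S|.
Proof.
move=> big_T /andP[S0 ST].
have half (A : {set double_graph}) (s : bool) (x : T) : (s, x) \in A ->
    #|[pred y | (s, y) \notin A]| <= #|edge_cut A| + 2.
  move=> xA; have := @sum_complement_ge x [pred y | (s, y) \notin A].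
  rewrite /= xA => /(_ isT) /leq_trans; apply; rewrite leq_add2r.
  rewrite (@card_edge_cut_pairs double_graph A) (bigD1 ((s, x) : double_graph)) //=.
  apply: leq_trans (leq_addr _ _); rewrite (sum_double _ s) /=.
  apply: leq_trans (leq_addr _ _); rewrite big_mkcond; apply: leq_sum => y _ /=.
  by rewrite xA /double_adj /= eqxx; case: ifP.
case: (boolP [exists s, exists x, exists y, ((s, x) \in S) && ((s, y) \notin S)]).
  move=> /existsP[s /existsP[x /existsP[y /andP[xS yS]]]].
  have h1 := half S s x xS.
  have h2 : #|[pred y | (s, y) \in S]| <= #|edge_cut S| + 2.
    rewrite -card_edge_cutC; have := half (~: S) s y; rewrite inE => /(_ yS).
    by rewrite (eq_card (B := [pred y | (s, y) \in S])) // => z; rewrite !inE negbK.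
  have cT : #|[pred y | (s, y) \in S]| + #|[pred y | (s, y) \notin S]| = #|T|.
    by rewrite -[RHS](cardC [pred y | (s, y) \in S]); congr (_ + _); apply: eq_card.
  move: (#|[pred y | (s, y) \in S]|) (#|[pred y | (s, y) \notin S]|) cT h1 h2 =>
    u w cT h1 h2.
  by move: (#|edge_cut S|) big_T h1 h2 => e; rewrite -cT; lia.
move=> /existsPn noS.
have const s x y : ((s, x) \in S) = ((s, y) \in S).
  have key u w : (s, u) \in S -> (s, w) \in S.
    move=> uS; have /existsPn /(_ u) /existsPn /(_ w) := noS s.
    by rewrite uS negbK.
  by apply/idP/idP; apply: key.
have /set0Pn[[s x] xS] := S0.
suff -> : S = block s by rewrite card_block_cut.
apply/setP => -[t y]; rewrite !inE /=; case: (eqVneq t s) => [->|ts].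
  by rewrite (const s y x).
apply/negbTE/negP => yS; case/eqP: ST; apply/setP => -[u z]; rewrite [RHS]inE.
have [->|->] : u = t \/ u = s by move: ts; case: u; case: t {yS}; case: s {xS}; auto.
  by rewrite (const t z y).
by rewrite (const s z x).
Qed.
End Doubling.

(* Per index: the path (0,false) - None - (0,true) and a perfect matching of the
   remaining pairs, so that the hub None has degree 2 and all others degree 1. *)
Definition pendant_compl (a : nat) (o o' : option ('I_a.+1 * bool)) : bool :=
  match o, o' with
  | None, None => false
  | None, Some p | Some p, None => p.1 == ord0
  | Some p, Some q => [&& p.1 == q.1, p.2 != q.2 & p.1 != ord0]
  end.

Definition sparse_rel (k a : nat) : rel ('I_k * option ('I_a.+1 * bool)) :=
  fun x y => (x.1 == y.1) && pendant_compl x.2 y.2.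

Definition is_hub (k a : nat) (x : 'I_k * option ('I_a.+1 * bool)) : bool := x.2 ==
  None.

Lemma sparse_rel_sym k a : symmetric (@sparse_rel k a).
Proof.
move=> [i [[p b]|]] [j [[q c]|]]; rewrite /sparse_rel /= eq_sym //.
by congr (_ && _); rewrite (eq_sym p) (eq_sym b); case: eqP => // ->.
Qed.

Lemma sparse_rel_irr k a : irreflexive (@sparse_rel k a).
Proof. by move=> [i [[p b]|]]; rewrite /sparse_rel /= ?eqxx ?andbF. Qed.

Lemma sum_option (A : finType) (F : option A -> nat) :
  \sum_o F o = F None + \sum_a F (Some a).
Proof.
rewrite (bigD1 None) //=; congr (_ + _).
rewrite (reindex_omap Some id) /=; last by case.
by apply: eq_bigl => o; rewrite eqxx.
Qed.

Lemma sparse_rel_deg k a (x : 'I_k * option ('I_a.+1 * bool)) :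
  \sum_y sparse_rel x y = (is_hub x).+1.
Proof.
case: x => i o; rewrite (eq_bigr (fun y => (i == y.1) && pendant_compl o y.2 : nat)) //.
rewrite -(pair_bigA _ (fun j o' => (i == j) && pendant_compl o o' : nat)) /=.
rewrite (bigD1 i) //= eqxx /= [X in _ + X]big1 ?addn0; last first.
  by move=> j /negbTE ji; rewrite big1 // => o' _; rewrite eq_sym ji.
rewrite sum_option /is_hub /=; case: o => [[p b]|] /=.
  rewrite (eq_bigr (fun q => (q == (p, ~~ b)) && (p != ord0) : nat)); last first.
    move=> [q c] _ /=; rewrite xpair_eqE (eq_sym p).
    by case: (q == p) => //=; case: b; case: c.
  rewrite (bigD1 (p, ~~ b)) //= eqxx big1 ?addn0; last by move=> q /negbTE ->.
  by case: (p == ord0).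
rewrite add0n (eq_bigr (fun q => (q.1 == ord0 : nat))) //.
rewrite -(pair_bigA _ (fun p (c : bool) => (p == ord0 : nat))) /=.
rewrite (bigD1 ord0) //= big_bool ?eqxx big1 ?addn0 //.
by move=> p /negbTE p0; rewrite big_bool p0.
Qed.

Lemma card_hubs k a : #|@is_hub k a| = k.
Proof.
rewrite -sum1_card big_mkcond /=.
rewrite (eq_bigr (fun y => (y.2 == None : nat))) => [|y _]; last first.
  by rewrite unfold_in /is_hub; case: (_ == _).
rewrite -(pair_bigA _ (fun (i : 'I_k) (o : option ('I_a.+1 * bool)) =>
  (o == None : nat))) /=.
rewrite (eq_bigr (fun=> 1)); first by rewrite sum_nat_const card_ord muln1.
by move=> i _; rewrite sum_option /= big1 ?addn0.
Qed.

(** The shift of [a] by 2 gives each side at least 7k vertices, which meets the size condition of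
    [double_cut_ge] already at [a = 0] and [k = 1]. *)
Definition hub_graph (k a : nat) : sgraph :=
  double_graph (@is_hub k a.+2) (@sparse_rel_sym k a.+2).

Definition hub_block (k a : nat) : {set hub_graph k a} :=
  block (@is_hub k a.+2) (@sparse_rel_sym k a.+2) true.

Definition hub_size (k a : nat) : nat := k * (2 * a + 7).

Lemma card_hub_side k a : #|{: 'I_k * option ('I_a.+3 * bool)}| = hub_size k a.
Proof. by rewrite card_prod card_option card_prod !card_ord card_bool /hub_size;
  lia. Qed.

Lemma card_hub_block k a : #|hub_block k a| = hub_size k a.
Proof. by rewrite card_block card_hub_side. Qed.

Lemma card_hub_blockC k a : #|~: hub_block k a| = hub_size k a.
Proof. by rewrite blockC card_block card_hub_side. Qed.

Lemma card_hub_cut k a : #|edge_cut (hub_block k a)| = k.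
Proof. by rewrite card_block_cut card_hubs. Qed.

Lemma hub_block_proper k a : 0 < k -> proper_vertex_set (hub_block k a).
Proof.
move=> k0; have b0 : 0 < hub_size k a by rewrite /hub_size; nia.
rewrite /proper_vertex_set -card_gt0 card_hub_block b0 /=.
apply: contraTneq b0 => e; rewrite -(card_hub_blockC k a) e -leqNgt leqn0 cards_eq0.
by rewrite setCT.
Qed.

Lemma hub_graph_regular k a : regular_graph (hub_graph k a) (hub_size k a).-2.
Proof.
rewrite -card_hub_side; apply: double_regular (@sparse_rel_irr k a.+2) _.
exact: sparse_rel_deg.
Qed.

Lemma hub_cut_ge k a (S : {set hub_graph k a}) : 0 < k ->
  proper_vertex_set S -> k <= #|edge_cut S|.
Proof.
move=> k0 PS; rewrite -{1}(card_hubs k a.+2).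
apply: double_cut_ge PS; first exact: sparse_rel_deg.
by rewrite card_hubs card_hub_side /hub_size; nia.
Qed.

Lemma hub_graph_edge_connectivity k a : 0 < k -> k <= edge_connectivity (hub_graph k a).
Proof.
move=> k0; apply: (le_edge_connectivity (hub_block_proper a k0)) => S.
exact: hub_cut_ge.
Qed.

Lemma hub_graph_connected k a : 0 < k -> connected_graph (hub_graph k a).
Proof.
move=> k0; apply: connected_of_cuts => [|S PS];
  last exact: leq_trans k0 (hub_cut_ge k0 PS).
have /andP[S0 _] := hub_block_proper a k0.
by rewrite -card_gt0 in S0; apply: leq_trans S0 (max_card _).
Qed.

(* Loaded here because classical_sets shadows the finset names and notations
   used above. *)
From mathcomp Require Import complex.
From mathcomp Require Import all_classical all_reals all_analysis.
From mathcomp Require Import ring lra.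
Import Order.TTheory GRing.Theory Num.Theory.
Import numFieldNormedType.Exports.
Local Open Scope classical_set_scope.
Local Open Scope ring_scope.

(** * The spectrum of the Laplacian *)

(** Over the complex numbers the matrix is Hermitian, so it is diagonalizable with real eigenvalues;
    a complex similarity between two real matrices can be replaced by a real one. The resulting [Q]
    is only known to be invertible, not orthogonal. *)
Lemma symmetric_diagonalizable (R : realType) (n : nat) (A : 'M[R]_n) :
  A^T = A ->
  exists Q : 'M[R]_n, exists D : 'rV[R]_n,
    Q \in unitmx /\ Q *m A = diag_mx D *m Q.
Proof.
move=> symA; pose toC := real_complex R.
pose B : 'M[complex R]_n := map_mx toC A.
have toC_real (x : R) : toC x \is Num.real by apply/complex_realP; exists x.
have Breal : B \is a mxOver Num.real by apply/mxOverP => i j; rewrite mxE.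
have Bsym : B \is symmetricmx.
  by apply/is_hermitianmxP; rewrite expr0 scale1r map_mx_id // map_trmx symA.
have Bherm := realsym_hermsym Bsym Breal.
have Dreal := hermitian_spectral_diag_real Bherm.
have /orthomx_spectralP Beq := hermitian_normalmx Bherm.
have sim : similar_in unitmx B (diag_mx (spectral_diag B)).
  exists (spectralmx B); first exact: spectral_unit.
  apply/similarP; first exact: spectral_unit.
  by rewrite {2}Beq !mulmxA mulmxV ?spectral_unit // mul1mx.
have DDreal : diag_mx (spectral_diag B) \is a mxOver Num.real.
  apply/mxOverP => i j; rewrite mxE; case: eqP => _; rewrite ?mulr1n ?mulr0n //.
  exact: (mxOverP Dreal).
have [P /andP[Preal Punit] simP] := real_similar sim Breal DDreal.
have toCre m1 m2 (X : 'M[complex R]_(m1, m2)) :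
    X \is a mxOver Num.real -> map_mx toC (map_mx (@complex.Re R) X) = X.
  by move=> Xr; apply/matrixP => i j; rewrite !mxE; apply: RRe_real;
    exact: (mxOverP Xr).
exists (map_mx (@complex.Re R) P), (map_mx (@complex.Re R) (spectral_diag B)).
split; first by rewrite -(map_unitmx toC) toCre.
apply: (@map_mx_inj _ _ toC).
rewrite !map_mxM map_diag_mx !toCre //.
by apply/(similarP Punit).
Qed.

Lemma char_poly_diagonalized (R : fieldType) (n : nat) (A Q : 'M[R]_n) (D : 'rV[R]_n) :
  Q \in unitmx -> Q *m A = diag_mx D *m Q ->
  char_poly A = \prod_(x <- [seq D 0 i | i <- enum 'I_n]) ('X - x%:P).
Proof.
move=> Qu QA.
have e : map_mx polyC Q *m char_poly_mx A = char_poly_mx (diag_mx D) *m map_mx polyC Q.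
  rewrite mulmxBr mulmxBl -!map_mxM /= QA; congr (_ - _).
  by rewrite scalar_mxC.
have /(mulfI _) : \det (map_mx polyC Q) * char_poly A = \det (map_mx polyC Q) *
  char_poly (diag_mx D).
  by rewrite -[LHS]det_mulmx e det_mulmx mulrC.
rewrite det_map_mx polyC_eq0 -unitfE -unitmxE => /(_ Qu) ->.
rewrite char_poly_trig; last exact/diag_mx_is_trig.
rewrite big_map big_enum /=; apply: eq_bigr => i _.
by rewrite mxE eqxx mulr1n.
Qed.

(** The characteristic polynomial splits, so the default of [xget] is never taken; its factorization
    determines the roots with multiplicity. *)
Lemma eigenvalues_diagonalized (R : realType) (n : nat) (A Q : 'M[R]_n) (D : 'rV[R]_n) :
  Q \in unitmx -> Q *m A = diag_mx D *m Q ->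
  perm_eq (eigenvalues A) [seq D 0 i | i <- enum 'I_n] /\ sorted <=%R (eigenvalues A).
Proof.
move=> Qu QA; rewrite /eigenvalues; split; last first.
  by apply: sort_sorted; exact: le_total.
rewrite perm_sort.
case: xgetP => [s _ /= Hs|/(_ [seq D 0 i | i <- enum 'I_n])]; last first.
  by move=> /(_ (char_poly_diagonalized Qu QA)).
by apply: prod_XsubC_eq; rewrite -Hs; apply: char_poly_diagonalized Qu QA.
Qed.

(** * The Laplacian on vertex functions and its quadratic form *)

Definition lap (R : realType) (G : sgraph) (f : G -> R) (x : G) : R :=
  \sum_y (adj x y)%:R * (f x - f y).

Lemma eq_lap (R : realType) (G : sgraph) (f g : G -> R) :
  f =1 g -> lap f =1 lap g.
Proof. by move=> fg x; apply: eq_bigr => y _; rewrite !fg. Qed.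

(** Green's identity: the double sum is averaged with its copy under exchange of x and y. The factor
    1/2 is there because each edge occurs in both directions. *)
Lemma sum_lapM (R : realType) (G : sgraph) (f g : G -> R) :
  \sum_x g x * lap f x =
  2^-1 * \sum_x \sum_y (adj x y)%:R * ((f x - f y) * (g x - g y)).
Proof.
have E1 : \sum_x g x * lap f x = \sum_x \sum_y (adj x y)%:R * ((f x - f y) * g x).
  by apply: eq_bigr => x _; rewrite mulr_sumr; apply: eq_bigr => y _; ring.
have E2 : \sum_x g x * lap f x = \sum_x \sum_y (adj x y)%:R * ((f x - f y) * - g y).
  rewrite E1 exchange_big; apply: eq_bigr => x _; apply: eq_bigr => y _.
  by rewrite adj_sym; ring.
have : (\sum_x g x * lap f x) *+ 2 =
    \sum_x \sum_y (adj x y)%:R * ((f x - f y) * (g x - g y)).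
  rewrite mulr2n {1}E1 E2 -big_split; apply: eq_bigr => x _ /=.
  by rewrite -big_split; apply: eq_bigr => y _ /=; ring.
by move=> <-; field.
Qed.

Lemma sum_lapMC (R : realType) (G : sgraph) (f g : G -> R) :
  \sum_x g x * lap f x = \sum_x f x * lap g x.
Proof.
rewrite !sum_lapM; congr (_ * _); apply: eq_bigr => x _.
by apply: eq_bigr => y _; ring.
Qed.

Lemma sum_lap (R : realType) (G : sgraph) (f : G -> R) : \sum_x lap f x = 0.
Proof.
have := sum_lapM f (fun=> 1); under eq_bigr do rewrite mul1r.
by move=> ->; rewrite big1 ?mulr0 // => x _; rewrite big1 // => y _; ring.
Qed.

Lemma sum_lap_ge0 (R : realType) (G : sgraph) (f : G -> R) :
  0 <= \sum_x f x * lap f x.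
Proof.
rewrite sum_lapM mulr_ge0 ?invr_ge0 //; apply: sumr_ge0 => x _.
by apply: sumr_ge0 => y _; rewrite mulr_ge0 // -expr2 sqr_ge0.
Qed.

(** The Dirichlet energy of [f] vanishes, so [f] agrees at the ends of every edge and hence along
    every path. *)
Lemma lap0_constant (R : realType) (G : sgraph) (f : G -> R) :
  connected_graph G -> (forall x, lap f x = 0) -> forall x y, f x = f y.
Proof.
move=> /andP[_ /forallP conG] f0.
have adjE x y : adj x y -> f x = f y.
  move=> xy; have := sum_lapM f f; rewrite big1; last by move=> z _; rewrite f0 mulr0.
  move=> /esym/eqP; rewrite mulf_eq0 invr_eq0 pnatr_eq0 /= psumr_eq0; last first.
    by move=> z _; apply: sumr_ge0 => t _; rewrite mulr_ge0 // -expr2 sqr_ge0.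
  move=> /allP /(_ x); rewrite mem_index_enum /= => /(_ isT).
  rewrite psumr_eq0; last first.
    by move=> t _; rewrite mulr_ge0 // -expr2 sqr_ge0.
  move=> /allP /(_ y); rewrite mem_index_enum /= => /(_ isT).
  by rewrite xy mul1r mulf_eq0 orbb subr_eq0 => /eqP.
move=> x y; have /forallP /(_ y) /connectP[p pxp ->] := conG x.
elim: p x pxp => //= z p IH x /andP[xz zp].
by rewrite (adjE _ _ xz); apply: IH.
Qed.

Lemma natr_degree (R : realType) (G : sgraph) (x : G) :
  (degree x)%:R = \sum_y (adj x y)%:R :> R.
Proof.
rewrite /degree -sum1_card natr_sum big_mkcond /=.
by apply: eq_bigr => y _; rewrite inE; case: ifP.
Qed.

Lemma mul_row_laplacian (R : realType) (G : sgraph) (v : 'rV[R]_#|G|) j :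
  (v *m laplacian R G) 0 j = lap (fun x => v 0 (enum_rank x)) (enum_val j).
Proof.
rewrite mxE /lap (reindex (@enum_val G G)) /=; last first.
  by apply: onW_bij; exists (@enum_rank G); [exact: enum_valK|exact: enum_rankK].
have -> : \sum_i v 0 i * laplacian R G i j =
   v 0 j * (degree (enum_val j))%:R - \sum_i v 0 i * (adj (enum_val i) (enum_val j))%:R.
  rewrite (eq_bigr (fun i => v 0 i * ((degree (enum_val i))%:R *+ (i == j))
     - v 0 i * (adj (enum_val i) (enum_val j))%:R)); last first.
    by move=> i _; rewrite !mxE mulrBr.
  rewrite sumrB (bigD1 j) //= eqxx big1 ?addr0 //.
  by move=> i /negbTE ->; rewrite mulr0n mulr0.
rewrite natr_degree (reindex (@enum_val G G)) /=; last first.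
  by apply: onW_bij; exists (@enum_rank G); [exact: enum_valK|exact: enum_rankK].
rewrite mulr_sumr -sumrB; apply: eq_bigr => i _.
by rewrite !enum_valK (adj_sym (enum_val i)); ring.
Qed.

Lemma trmx_laplacian (R : realType) (G : sgraph) : (laplacian R G)^T = laplacian R G.
Proof.
apply/matrixP => i j; rewrite !mxE adj_sym (eq_sym j).
by case: eqP => [->|].
Qed.

(** Used with [b] the eigenvalue 0 of the constants: the entry of index 1 is then the minimum of the
    remaining eigenvalues. *)
Lemma sorted_perm_min (R : realType) (e t : seq R) (b : R) :
  sorted <=%R e -> perm_eq e (b :: t) -> {in t, forall x, b <= x} -> t != [::] ->
  e`_1 \in t /\ {in t, forall x, e`_1 <= x}.
Proof.
move=> se pe bt t0.
have st : sorted <=%R (sort <=%R t) by apply: sort_sorted; exact: le_total.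
have -> : e = b :: sort <=%R t.
  apply: (sorted_eq le_trans le_anti se).
    rewrite /= path_min_sorted //.
    by apply/allP => x; rewrite mem_sort; apply: bt.
  by rewrite (perm_trans pe) // perm_cons perm_sym perm_sort.
have mt : sort <=%R t =i t by exact: mem_sort.
move: st mt; have : sort <=%R t != [::].
  by rewrite -size_eq0 size_sort size_eq0.
case: (sort <=%R t) => //= a s _ st mt.
split; first by rewrite -mt mem_head.
move=> x; rewrite -mt inE => /predU1P[->//|xs].
by have /allP/(_ _ xs) := order_path_min le_trans st.
Qed.

(* The index [i0] carries the eigenvalue 0, with constant eigenvector [b]. *)
Lemma laplacian_spectrum (R : realType) (G : sgraph) :
  connected_graph G -> (1 < #|G|)%N ->
  exists (q : 'I_#|G| -> G -> R) (D : 'I_#|G| -> R) (i0 : 'I_#|G|) (b : R),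
  [/\ forall i x, lap (q i) x = D i * q i x,
      b != 0 /\ (forall x, q i0 x = b),
      forall h : G -> R, exists c : 'I_#|G| -> R, forall x, h x = \sum_i c i * q i x,
      forall i, exists x, q i x != 0
    & [/\ forall i, i != i0 -> mu R G <=
      D i, 0 < mu R G & exists i, i != i0 /\ D i = mu R G]].
Proof.
move=> conG G1.
have [Q [D [Qu QL]]] := symmetric_diagonalizable (trmx_laplacian R G).
pose q i x := Q i (enum_rank x).
have qE i x : lap (q i) x = D 0 i * q i x.
  have := congr1 (fun M : 'M[R]_(#|G|) => M i (enum_rank x)) QL.
  rewrite mul_diag_mx !mxE => <-.
  have := mul_row_laplacian (row i Q) (enum_rank x); rewrite enum_rankK.
  have -> : lap (fun y => row i Q 0 (enum_rank y)) x = lap (q i) x.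
    by apply: eq_lap => y; rewrite mxE.
  by move=> <-; rewrite mxE; apply: eq_bigr => j _; rewrite [row i Q 0 j]mxE.
have qspan (h : G -> R) : exists c : 'I_#|G| -> R, forall x, h x = \sum_i c i * q i x.
  pose v : 'rV[R]_(#|G|) := \row_i h (enum_val i).
  exists (fun i => (v *m invmx Q) 0 i) => x.
  have := congr1 (fun M : 'rV[R]_(#|G|) => M 0 (enum_rank x)) (mulmxKV Qu v).
  by rewrite mxE [in RHS]mxE enum_rankK => <-.
have qfree (c : 'I_#|G| -> R) : (forall x, \sum_i c i * q i x = 0) -> forall i, c i = 0.
  move=> c0 i; have : (\row_i c i) *m Q = 0.
    apply/rowP => j; rewrite !mxE -[RHS](c0 (enum_val j)).
    by apply: eq_bigr => k _; rewrite mxE /q enum_valK.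
  move=> /(congr1 (mulmx^~ (invmx Q))); rewrite mulmxK // mul0mx => /rowP /(_ i).
  by rewrite !mxE.
have qn0 i : exists x, q i x != 0.
  apply: contrapT => /forallNP q0.
  have := qfree (fun j => (j == i)%:R) _ i; rewrite eqxx => H.
  suff : 1 = 0 :> R by move/eqP; rewrite oner_eq0.
  apply: H => x; rewrite (bigD1 i) //= eqxx mul1r big1 ?addr0.
    by apply/eqP/negP => /negP /q0.
  by move=> j /negbTE ->; rewrite mul0r.
have Dge0 i : 0 <= D 0 i.
  have [x qx] := qn0 i; have := sum_lap_ge0 (q i).
  rewrite (eq_bigr (fun x => D 0 i * q i x ^+ 2)); last by move=> y _; rewrite qE; ring.
  rewrite -mulr_sumr pmulr_lge0 // (bigD1 x) //= ltr_wpDr //.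
    by apply: sumr_ge0 => y _; apply: sqr_ge0.
  by rewrite exprn_even_gt0.
have x0 : G := enum_val (Ordinal (ltnW G1)).
(* Expand the constant 1 in the eigenvectors. The Laplacian kills it, so every [c i * D 0 i]
   vanishes, and nonzero eigenvalues throughout would give 1 = 0. *)
have [i0 Di0] : exists i0, D 0 i0 = 0.
  have [c cE] := qspan (fun=> 1).
  have c0 : forall i, c i * D 0 i = 0.
    apply: qfree => x.
    transitivity (lap (fun=> 1 : R) x); last first.
      by rewrite /lap big1 // => y _; rewrite subrr mulr0.
    rewrite (eq_lap cE) /lap.
    under [RHS]eq_bigr do rewrite -sumrB mulr_sumr.
    rewrite exchange_big /=; apply: eq_bigr => i _ /=.
    rewrite -mulrA -qE /lap mulr_sumr; apply: eq_bigr => y _; ring.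
  apply: contrapT => /forallNP D0.
  have := cE x0; rewrite big1 => [/eqP|i _]; first by rewrite oner_eq0.
  by have /eqP := c0 i; rewrite mulf_eq0 (negbTE (introN eqP (D0 i))) orbF =>
    /eqP ->; rewrite mul0r.
have qconst i : D 0 i = 0 -> forall x, q i x = q i x0.
  by move=> Di x; apply: lap0_constant => // y; rewrite qE Di mul0r.
have b0 : q i0 x0 != 0.
  by have [x] := qn0 i0; rewrite qconst.
have Dgt0 i : i != i0 -> 0 < D 0 i.
  move=> ii0; rewrite lt_neqAle Dge0 andbT; apply/eqP => /esym Di.
  (* A second eigenvector for 0 would also be constant, hence proportional to the first, against
     independence. *)
  have := qfree (fun j => (j == i)%:R * q i0 x0 - (j == i0)%:R * q i x0) _ i.
  rewrite eqxx (negbTE ii0) mul1r mul0r subr0 => H; move/eqP: b0; apply; apply: H => x.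
  have i0i : (i0 == i) = false by rewrite eq_sym (negbTE ii0).
  rewrite (bigD1 i) //= (bigD1 i0) /= ?i0i // !eqxx ?i0i ?(negbTE ii0).
  rewrite big1 ?addr0; last by move=> j /andP[/negbTE -> /negbTE ->];
    rewrite !mul0r subrr mul0r.
  by rewrite !mul1r !mul0r subr0 sub0r (qconst i) // (qconst i0) //; ring.
have [pe se] := eigenvalues_diagonalized Qu QL.
pose t := [seq D 0 i | i <- enum 'I_#|G| & i != i0].
have pt : perm_eq (eigenvalues (laplacian R G)) (0 :: t).
  apply: perm_trans pe _; rewrite -Di0 /t -(map_cons (fun i => D 0 i)) perm_map //.
  apply: (perm_trans (perm_to_rem (_ : i0 \in enum 'I_#|G|)));
    first by rewrite mem_enum.
  by rewrite rem_filter ?enum_uniq.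
have tn0 : t != [::].
  rewrite -size_eq0 size_map size_filter -lt0n -has_count; apply/hasP.
  have : (1 < size (enum 'I_#|G|))%N by rewrite size_enum_ord.
  case: (eqVneq i0 (Ordinal (ltnW G1))) => [->|ne].
    by exists (Ordinal G1); rewrite ?mem_enum.
  by exists (Ordinal (ltnW G1)); rewrite ?mem_enum // eq_sym.
have [|mt mint] := sorted_perm_min se pt _ tn0.
  by move=> _ /mapP[i _ ->].
exists q, (fun i => D 0 i), i0, (q i0 x0); split => //.
  by split=> // x; apply: qconst.
have /mapP[j] := mt; rewrite mem_filter => /andP[ji0 _] Ej.
rewrite /mu; split.
- by move=> i ii0; apply: mint; apply/mapP; exists i;
  rewrite // mem_filter ii0 mem_enum.
- by rewrite Ej Dgt0.
- by exists j.
Qed.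

Lemma mu_eigenfunction (R : realType) (G : sgraph) :
  connected_graph G -> (1 < #|G|)%N ->
  exists f : G -> R, [/\ exists x, f x != 0, \sum_x f x = 0, 0 < mu R G
                       & forall x, lap f x = mu R G * f x].
Proof.
move=> conG G1.
have [q [D [i0 [b [qE _ _ qn0 [_ mu0 [i [_ Di]]]]]]]] := laplacian_spectrum R conG G1.
exists (q i); split => //; last by move=> x; rewrite qE Di.
have := sum_lap (q i); under eq_bigr do rewrite qE Di.
by rewrite -mulr_sumr => /eqP; rewrite mulf_eq0 gt_eqF //= => /eqP.
Qed.

(* The eigenvectors q i need not be orthogonal inside an eigenspace; weighting
   their coefficients by the square roots of D i - mu still writes
   <h, L h> - mu <h, h> as a squared norm. *)
Lemma mu_rayleigh (R : realType) (G : sgraph) (h : G -> R) :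
  connected_graph G -> (1 < #|G|)%N -> \sum_x h x = 0 ->
  mu R G * \sum_x h x ^+ 2 <= \sum_x h x * lap h x.
Proof.
move=> conG G1 h0.
have [q [D [i0 [b [qE [b0 qb] qspan _ [muD mu0 _]]]]]] := laplacian_spectrum R conG G1.
have sum0 i : i != i0 -> \sum_x q i x = 0.
  move=> ii0; have := sum_lap (q i); under eq_bigr do rewrite qE.
  rewrite -mulr_sumr => /eqP; rewrite mulf_eq0 gt_eqF ?(lt_le_trans mu0) ?muD //=.
  by move=> /eqP.
have ortho i j : D i != D j -> \sum_x q i x * q j x = 0.
  move=> ij; have := sum_lapMC (q j) (q i).
  under eq_bigr do rewrite qE; under [RHS]eq_bigr do rewrite qE.
  rewrite (eq_bigr (fun x => D j * (q i x * q j x))) => [|x _]; last by ring.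
  rewrite [RHS](eq_bigr (fun x => D i * (q i x * q j x))) => [|x _]; last by ring.
  rewrite -!mulr_sumr => /eqP; rewrite -subr_eq0 -mulrBl mulf_eq0 subr_eq0.
  by rewrite eq_sym (negbTE ij) => /eqP.
have [c hE] := qspan h.
have c0 : c i0 = 0.
  move: h0; under eq_bigr do rewrite hE.
  rewrite exchange_big /= (bigD1 i0) //= [X in _ + X]big1 => [|i ii0]; last first.
    by rewrite -mulr_sumr sum0 // mulr0.
  rewrite addr0 -mulr_sumr; under eq_bigr do rewrite qb.
  rewrite sumr_const => /eqP; rewrite mulf_eq0 mulrn_eq0 (negbTE b0) orbF.
  by rewrite -leqn0 leqNgt (ltnW G1) /= orbF => /eqP.
have lapE x : lap h x = \sum_i c i * D i * q i x.
  rewrite (eq_lap hE) /lap.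
  under eq_bigr do rewrite -sumrB mulr_sumr.
  rewrite exchange_big /=; apply: eq_bigr => i _ /=.
  rewrite -mulrA -qE /lap mulr_sumr; apply: eq_bigr => y _; ring.
rewrite -subr_ge0 mulr_sumr -sumrB.
have -> : \sum_x (h x * lap h x - mu R G * h x ^+ 2) =
    \sum_i \sum_j c i * c j * (D j - mu R G) * \sum_x q i x * q j x.
  have E x : h x * lap h x - mu R G * h x ^+ 2 =
      \sum_i \sum_j c i * c j * (D j - mu R G) * (q i x * q j x).
    have -> : h x * lap h x - mu R G * h x ^+ 2 = h x * (lap h x - mu R G * h x)
      by ring.
    rewrite lapE {1}hE mulr_suml.
    apply: eq_bigr => i _; rewrite hE mulr_sumr -sumrB mulr_sumr.
    by apply: eq_bigr => j _; ring.
  under eq_bigr do rewrite E.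
  rewrite exchange_big /=; apply: eq_bigr => i _; rewrite exchange_big.
  by apply: eq_bigr => j _; rewrite mulr_sumr.
(* The radicand is nonnegative except at [i0], whose coefficient [c i0] vanishes. *)
pose w i := Num.sqrt (D i - mu R G).
have -> : \sum_i \sum_j c i * c j * (D j - mu R G) * \sum_x q i x * q j x =
    \sum_x (\sum_i w i * c i * q i x) ^+ 2.
  have E x : (\sum_i w i * c i * q i x) ^+ 2 =
     \sum_i \sum_j (w i * w j) * c i * c j * (q i x * q j x).
    rewrite expr2 mulr_suml; apply: eq_bigr => i _; rewrite mulr_sumr.
    by apply: eq_bigr => j _; ring.
  under [RHS]eq_bigr do rewrite E.
  rewrite [RHS]exchange_big /=; apply: eq_bigr => i _; rewrite exchange_big.
  apply: eq_bigr => j _; rewrite -mulr_sumr.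
  have [Dij|Dij] := eqVneq (D i) (D j); last by rewrite ortho // !mulr0.
  have [->|ii0] := eqVneq i i0; first by rewrite c0 !(mulr0, mul0r).
  rewrite /w Dij -expr2 sqr_sqrtr ?subr_ge0 -?Dij ?muD //.
  by congr (_ * _); ring.
by apply: sumr_ge0 => x _; apply: sqr_ge0.
Qed.

(** * A discrete Hardy inequality *)

(** The sum of squared deviations from the mean is nonnegative. *)
Lemma sqr_sum_le (R : realType) (I : Type) (r : seq I) (a : I -> R) :
  (\sum_(i <- r) a i) ^+ 2 <= (size r)%:R * \sum_(i <- r) a i ^+ 2.
Proof.
case: r => [|j r]; first by rewrite !big_nil mulr0 expr0n.
set s := j :: r; set A := \sum_(i <- s) a i; set B := \sum_(i <- s) a i ^+ 2.
have m0 : 0 < (size s)%:R :> R by rewrite ltr0n.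
have : 0 <= \sum_(i <- s) (a i - A / (size s)%:R) ^+ 2.
  by apply: sumr_ge0 => i _; apply: sqr_ge0.
rewrite (eq_bigr (fun i => a i ^+ 2 - (a i * (2 * (A / (size s)%:R)) - (A / (size
  s)%:R) ^+ 2))); last first.
  by move=> i _; ring.
rewrite sumrB sumrB -mulr_suml -/A -/B big_const_seq count_predT iter_addr_0 -[X in _
  - (_ - X)]mulr_natl.
have -> : B - (A * (2 * (A / (size s)%:R)) - (size s)%:R * (A / (size s)%:R) ^+ 2) =
   ((size s)%:R * B - A ^+ 2) / (size s)%:R by field; rewrite gt_eqF.
by rewrite pmulr_lge0 ?invr_gt0 // subr_ge0.
Qed.

Lemma sum_sqr_by_parts (R : realType) (a : nat -> R) (n : nat) :
  let M i := - \sum_(0 <= j < i) a j in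
  M n.+1 = 0 ->
  \sum_(0 <= i < n.+1) a i ^+ 2 = \sum_(1 <= i < n.+1) M i * (a i - a i.-1).
Proof.
move=> M Mn.
have MS i : M i.+1 = M i - a i by rewrite /M big_nat_recr //= opprD.
(* Abel summation with its boundary term, which makes the induction possible without
   [M n.+1 = 0]. *)
suff -> : \sum_(0 <= i < n.+1) a i ^+ 2 =
    \sum_(1 <= i < n.+1) M i * (a i - a i.-1) - M n.+1 * a n by rewrite Mn; ring.
elim: n {Mn} => [|n IH].
  by rewrite big_nat1 big_geq // MS /M big_geq //; ring.
by rewrite big_nat_recr //= IH [in RHS]big_nat_recr //= (MS n.+1); ring.
Qed.

Section Hardy.
Variables (R : realType) (a : nat -> R) (n : nat).
Let M i := - \sum_(0 <= j < i) a j.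
Hypothesis Mn : M n = 0.

Let M0 : M 0 = 0.
Proof. by rewrite /M big_geq // oppr0. Qed.

(** Between [p] and [q] the polygon of the [M i] has at least the Dirichlet energy of its chord. *)
Let energy_step p q : (p < q)%N ->
  (M q - M p) ^+ 2 / (q%:R - p%:R) <= \sum_(p <= i < q) a i ^+ 2.
Proof.
move=> pq; rewrite -natrB ?(ltnW pq) // ler_pdivrMr ?ltr0n ?subn_gt0 // mulrC.
have -> : M q - M p = - \sum_(p <= i < q) a i.
  by rewrite /M (big_cat_nat (n := p)) ?(ltnW pq) //=; ring.
by rewrite sqrrN; apply: le_trans (sqr_sum_le _ _) _; rewrite size_iota.
Qed.

(** Two chords, from 0 to [q] and from [q] to [n], with energies M^2 / q and M^2 / (n - q). *)
Lemma hardy_one (q : nat) : (0 < q < n)%N ->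
  n%:R * M q ^+ 2 <= q%:R * (n%:R - q%:R) * \sum_(0 <= i < n) a i ^+ 2.
Proof.
move=> /andP[q0 qn]; rewrite (big_cat_nat (n := q)) ?(ltnW qn) //=.
have := energy_step q0; have := energy_step qn.
rewrite Mn M0 !subr0 sub0r sqrrN.
have q0' : 0 < q%:R :> R by rewrite ltr0n.
have nq0 : 0 < n%:R - q%:R :> R by rewrite subr_gt0 ltr_nat.
set X := \sum_(0 <= i < q) _; set Y := \sum_(q <= i < n) _.
rewrite !ler_pdivrMr // => hY hX.
have -> : n%:R * M q ^+ 2 = (n%:R - q%:R) * M q ^+ 2
   + q%:R * M q ^+ 2 by ring.
have -> : q%:R * (n%:R - q%:R) * (X + Y) = (n%:R - q%:R) * (X * q%:R) +
  q%:R * (Y * (n%:R - q%:R)).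
  by ring.
by apply: lerD; rewrite ler_pM2l.
Qed.

Variables (phi : nat -> R) (D : nat) (C : R).
Let slope p q := (phi q - phi p) / (q%:R - p%:R).
Let far p q := (p + D <= q)%N.
Hypotheses (D0 : (0 < D)%N) (phi0 : phi 0%N = 0) (phin : phi n = 0).
Hypothesis phi_gt0 : forall q, (0 < q < n)%N -> 0 < phi q.
Hypothesis supersolution : forall p q r, far p q -> far q r -> (r <= n)%N ->
  (r + D <= n + p)%N -> C * phi q <= slope p q - slope q r.

Let far_rcons q l : path far q (rcons l n) -> (q + D <= n)%N.
Proof.
elim: l q => [|r l IH] q /=; first by rewrite andbT.
by move=> /andP[qr /IH]; rewrite /far in qr *; lia.
Qed.

(* Picone's inequality with [phi] in the role of a positive supersolution. *)
Let picone (x y p q h : R) : 0 < p -> 0 < q -> 0 < h ->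
  (p - q) / h * (x ^+ 2 / p - y ^+ 2 / q) <= (x - y) ^+ 2 / h.
Proof.
move=> p0 q0 h0; rewrite -subr_ge0.
have -> : (x - y) ^+ 2 / h - (p - q) / h * (x ^+ 2 / p - y ^+ 2 / q) =
   (x * q - y * p) ^+ 2 / (p * q * h) by field; rewrite !gt_eqF.
by rewrite divr_ge0 ?sqr_ge0 // !mulr_ge0 // ltW.
Qed.

(** Induction on the knots to the right of [q]. The slope term is what the Picone inequality on the
    interval ending at [q] will pay for. The last condition provides a further gap of length [D]
    outside the current triple of knots, as [supersolution] requires. *)
Let hardy_path l p q : far p q -> path far q (rcons l n) -> (D <= p)%N || (l != [::]) ->
  C * \sum_(x <- q :: l) M x ^+ 2 <=
  slope p q * (M q ^+ 2 / phi q) + \sum_(q <= i < n) a i ^+ 2.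
Proof.
elim: l p q => [|r l IH] p q pq.
  rewrite /= andbT orbF => qn Ep.
  have q_n : (0 < q < n)%N by rewrite /far in pq qn; lia.
  have q0 := phi_gt0 q_n.
  have nq0 : 0 < n%:R - q%:R :> R by rewrite subr_gt0 ltr_nat; case/andP: q_n.
  have /energy_step : (q < n)%N by case/andP: q_n.
  rewrite Mn sub0r sqrrN big_seq1 => h.
  have /(ler_wpM2r (_ : 0 <= M q ^+ 2 / phi q)) : C * phi q <= slope p q - slope q n.
    by apply: supersolution => //; lia.
  rewrite divr_ge0 ?sqr_ge0 ?(ltW q0) // => /(_ isT).
  have -> : C * phi q * (M q ^+ 2 / phi q) = C * M q ^+ 2 by field; rewrite gt_eqF.
  move=> /le_trans; apply; rewrite mulrBl lerD2l; apply: le_trans h.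
  rewrite /slope phin le_eqVlt; apply/orP; left; apply/eqP.
  by field; rewrite !gt_eqF.
rewrite [path _ _ _]/= => /andP[qr rl] Ep.
have rn := far_rcons rl.
have q_n : (0 < q < n)%N by rewrite /far in pq qr; lia.
have r_n : (0 < r < n)%N by rewrite /far in pq qr; lia.
have q0 := phi_gt0 q_n; have r0 := phi_gt0 r_n.
have q_r : (q < r)%N by rewrite /far in qr; lia.
have rq0 : 0 < r%:R - q%:R :> R by rewrite subr_gt0 ltr_nat.
have {}IH : C * \sum_(x <- r :: l) M x ^+ 2 <=
    slope q r * (M r ^+ 2 / phi r) + \sum_(r <= i < n) a i ^+ 2.
  by apply: IH => //; rewrite /far in pq; lia.
have /(ler_wpM2r (_ : 0 <= M q ^+ 2 / phi q)) : C * phi q <= slope p q - slope q r.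
  by apply: supersolution => //; rewrite /far in pq qr; lia.
rewrite divr_ge0 ?sqr_ge0 ?(ltW q0) // => /(_ isT).
have -> : C * phi q * (M q ^+ 2 / phi q) = C * M q ^+ 2 by field; rewrite gt_eqF.
have := picone (M r) (M q) r0 q0 rq0.
rewrite -/(slope q r) => /le_trans /(_ (energy_step q_r)).
have r_le_n : (r <= n)%N by lia.
have -> : \sum_(q <= i < n) a i ^+ 2 = \sum_(q <= i < r) a i ^+ 2 + \sum_(r <=
  i < n) a i ^+ 2.
  by rewrite (big_cat_nat (n := r)) // ltnW.
rewrite [X in C * X <= _]big_cons => h1 h2; move: IH h1 h2.
set x := M r ^+ 2 / phi r; set y := M q ^+ 2 / phi q.
move: x y => x y *; lra.
Qed.

(** With two interior knots, any three consecutive knots leave a gap of length [D] over. On the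
    first interval the slope term equals M^2 / q, the energy of the chord from 0. *)
Lemma hardy l : path far 0 (rcons l n) -> (1 < size l)%N ->
  C * \sum_(x <- l) M x ^+ 2 <= \sum_(0 <= i < n) a i ^+ 2.
Proof.
case: l => // q l; rewrite [path _ _ _]/= => /andP[oq ql] l1.
have qn := far_rcons ql.
have q_n : (0 < q < n)%N by rewrite /far in oq; lia.
have lnil : l != [::] by case: l {ql qn} l1.
have : (D <= 0)%N || (l != [::]) by rewrite lnil orbT.
move=> /(hardy_path oq ql) /le_trans; apply.
have q_le_n : (q <= n)%N by lia.
rewrite [leRHS](big_cat_nat (n := q)) //=.
rewrite lerD2r; have /energy_step : (0 < q)%N by case/andP: q_n.
apply: le_trans; rewrite /slope phi0 M0 !subr0.
have q0 := phi_gt0 q_n; have qq0 : 0 < q%:R :> R by rewrite ltr0n; case/andP: q_n.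
rewrite le_eqVlt; apply/orP; left; apply/eqP.
by field; rewrite !gt_eqF.
Qed.
End Hardy.

(** * A polynomial supersolution *)

Definition quartic (R : realType) (t : R) : R := t * (1 - t) + (t * (1 - t)) ^+ 2 / 12.

(* Two knots at distance at least [dl] from each other rule out the extremal
   configuration of the parabola, and adding a small multiple of its square
   improves the constant. *)
Lemma quartic_supersolution (R : realType) (t a b dl : R) :
  0 < dl -> dl <= a -> dl <= b -> 0 <= t <= 1 -> a + b <= 1 - dl ->
  8 * dl * (101 / 100) * quartic t <=
    (quartic t - quartic (t - a)) / a - (quartic (t + b) - quartic t) / b.
Proof.
move=> d0 da db /andP[t0 t1] ab; pose u (x : R) := x * (1 - x); set phi := @quartic R.
(* [s] is the offset from the centre and [e] the slack in a + b >= 2 dl; the spare gap gives 3 dl +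
   e <= 1. *)
pose s := t - 1 / 2; pose e := a + b - 2 * dl.
have a0 : a != 0 by rewrite gt_eqF //; lra.
have b0 : b != 0 by rewrite gt_eqF //; lra.
pose B := 1 / 2 - 6 * s ^+ 2 + 4 * s * (a - b) - (a ^+ 2 - a * b + b ^+ 2).
(* The parabola alone contributes a + b, and [B] comes from its square. *)
have -> : (phi t - phi (t - a)) / a - (phi (t + b) - phi t) / b = (a + b) * (1 +
  B / 12).
  by rewrite /phi /quartic /B /s; field; apply/andP.
have e0 : 0 <= e by rewrite /e; lra.
have e3 : 3 * dl + e <= 1 by rewrite /e; lra.
have ut : u t = 1 / 4 - s ^+ 2 by rewrite /u /s; field.
have s2 : 0 <= s ^+ 2 by apply: sqr_ge0.
have u0 : 0 <= u t by rewrite /u mulr_ge0 //; lra.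
have phit : phi t <= (1 / 4 - s ^+ 2) * (49 / 48).
  have : u t ^+ 2 <= u t * (1 / 4) by rewrite expr2 ler_wpM2l // ut; lra.
  by rewrite /phi /quartic -/(u t) -ut; lra.
have sab : - (2 * e) <= 4 * s * (a - b).
  have : `|4 * s * (a - b)| <= 2 * e.
    rewrite normrM ler_pM //; first by rewrite ler_norml /s; lra.
    by rewrite ler_norml /e; lra.
  by rewrite ler_norml => /andP[].
have quad : a ^+ 2 - a * b + b ^+ 2 <= 1 / 9 + e / 3 + e.
  have -> : a ^+ 2 - a * b + b ^+ 2 = dl ^+ 2 + dl * e +
    e ^+ 2 - 3 * ((a - dl) * (b - dl)).
    by rewrite /e; ring.
  have h1 : 0 <= (a - dl) * (b - dl) by rewrite mulr_ge0 //; lra.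
  have h2 : dl ^+ 2 <= 1 / 9.
    have : dl * dl <= 1 / 3 * (1 / 3) by rewrite ler_pM //; lra.
    by rewrite expr2; lra.
  have h3 : dl * e <= 1 / 3 * e by rewrite ler_wpM2r //; lra.
  have h4 : e ^+ 2 <= 1 * e by rewrite expr2 ler_wpM2r //; lra.
  lra.
(* 223/216 is 1 + (1/2 - 1/9) / 12, and 5/18 collects 2 + 1/3 + 1 over 12. *)
have lowB : 223 / 216 - s ^+ 2 / 2 - 5 * e / 18 <= 1 + B / 12 by rewrite /B; lra.
apply: (@le_trans _ _ ((a + b) * (223 / 216 - s ^+ 2 / 2 - 5 * e / 18))); last first.
  by rewrite ler_wpM2l //; lra.
apply: (@le_trans _ _ (8 * dl * (101 / 100) * ((1 / 4 - s ^+ 2) * (49 / 48)))).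
  by rewrite ler_wpM2l //; lra.
have -> : a + b = 2 * dl + e by rewrite /e; ring.
have s4 : s ^+ 2 <= 1 / 4 by rewrite ut in u0; lra.
have hs : 0 <= dl * s ^+ 2 by rewrite mulr_ge0 //; lra.
(* The terms with a factor [e], including the cross term from 2 dl, are nonnegative together. The
   rest comes down to (101/100) (49/48) <= 223/216. *)
have he : 0 <= e * (223 / 216 - s ^+ 2 / 2 - 5 * e / 18 - 5 * dl / 9)
  by rewrite mulr_ge0 //; lra.
lra.
Qed.

Lemma scaled_quartic_supersolution (R : realType) (n D p q r : nat) : (0 < D)%N ->
  (p + D <= q)%N -> (q + D <= r)%N -> (r <= n)%N -> (r + D <= n + p)%N ->
  8 * D%:R / n%:R ^+ 2 * (101 / 100) * @quartic R (q%:R / n%:R) <=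
  (quartic (q%:R / n%:R) - quartic (p%:R / n%:R)) / (q%:R - p%:R) - (quartic (r%:R /
    n%:R) - quartic (q%:R / n%:R)) / (r%:R - q%:R).
Proof.
move=> D0 pq qr rn rD; set phi := @quartic R.
have n0 : 0 < n%:R :> R by rewrite ltr0n; lia.
have D0' : 0 < D%:R :> R by rewrite ltr0n.
have pq' : p%:R + D%:R <= q%:R :> R by rewrite -natrD ler_nat.
have qr' : q%:R + D%:R <= r%:R :> R by rewrite -natrD ler_nat.
have rn' : r%:R <= n%:R :> R by rewrite ler_nat.
have rD' : r%:R + D%:R <= n%:R + p%:R :> R by rewrite -!natrD ler_nat.
have p0' : 0 <= p%:R :> R by [].
have qp0 : q%:R - p%:R != 0 :> R by rewrite gt_eqF //; lra.
have rq0 : r%:R - q%:R != 0 :> R by rewrite gt_eqF //; lra.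
have := @quartic_supersolution R (q%:R / n%:R) ((q%:R - p%:R) / n%:R)
  ((r%:R - q%:R) / n%:R) (D%:R / n%:R).
rewrite divr_gt0 // !ler_pM2r ?invr_gt0 // => /(_ isT).
have -> : D%:R <= q%:R - p%:R :> R by lra.
have -> : D%:R <= r%:R - q%:R :> R by lra.
have tn : (0 <= (q%:R / n%:R : R)) && ((q%:R / n%:R : R) <= 1).
  by rewrite divr_ge0 ?ler0n //= ler_pdivrMr // mul1r; lra.
move=> /(_ isT isT tn).
have -> : (q%:R - p%:R) / n%:R + (r%:R - q%:R) / n%:R <= 1 - D%:R / n%:R :> R.
  rewrite -mulrDl lerBrDr -mulrDl ler_pdivrMr // mul1r; lra.
move=> /(_ isT) /=.
have -> : q%:R / n%:R - (q%:R - p%:R) / n%:R = p%:R / n%:R :> R by ring.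
have -> : q%:R / n%:R + (r%:R - q%:R) / n%:R = r%:R / n%:R :> R by ring.
rewrite -/phi => h.
rewrite -(ler_pM2r n0).
have -> : 8 * D%:R / n%:R ^+ 2 * (101 / 100) * phi (q%:R / n%:R) * n%:R =
  8 * (D%:R / n%:R) * (101 / 100) * phi (q%:R / n%:R) by field; rewrite gt_eqF.
apply: le_trans h _; rewrite le_eqVlt; apply/orP; left; apply/eqP.
by field; rewrite rq0 qp0 gt_eqF.
Qed.

(** * Low cuts of an eigenfunction *)

(** A divergence theorem: the contributions of the edges inside [S] cancel by antisymmetry. *)
Lemma lap_flux (R : realType) (G : sgraph) (f : G -> R) (S : {set G}) :
  \sum_(x in S) \sum_(y | y \notin S) (adj x y)%:R * (f y - f x) =
  - \sum_(x in S) lap f x.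
Proof.
have anti : \sum_(x in S) \sum_(y in S) (adj x y)%:R * (f x - f y) = 0.
  set A := LHS; suff : A *+ 2 = 0 by move=> /eqP; rewrite mulrn_eq0 => /eqP.
  rewrite mulr2n {1}/A exchange_big /= -big_split big1 // => x _ /=.
  by rewrite -big_split big1 // => y _ /=; rewrite adj_sym; ring.
have -> : \sum_(x in S) lap f x = \sum_(x in S) (\sum_(y in S) (adj x y)%:R * (f x -
  f y) +
                           \sum_(y | y \notin S) (adj x y)%:R * (f x - f y)).
  by apply: eq_bigr => x _; rewrite /lap (bigID (mem S)).
rewrite big_split /= anti add0r -sumrN; apply: eq_bigr => x _.
by rewrite -sumrN; apply: eq_bigr => y _; ring.
Qed.

Section Flow.
Variables (R : realType) (G : sgraph) (f : G -> R) (m : R).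
Hypotheses (m_ge0 : 0 <= m) (f0 : \sum_x f x = 0) (lapf : forall x, lap f x = m * f x).
Let N := 2^-1 * \sum_x `|f x|.

(** The left side is also the sum of [f] over the complement; averaging the two trivial bounds gives
    half the L1 norm. *)
Lemma oppr_sum_le_half (S : {set G}) : - \sum_(x in S) f x <= N.
Proof.
have e : \sum_(x in S) f x + \sum_(x | x \notin S) f x = 0.
  by rewrite -[RHS]f0 [in RHS](bigID (mem S)).
have e2 : \sum_x `|f x| = \sum_(x in S) `|f x| + \sum_(x | x \notin S) `|f x|.
  by rewrite (bigID (mem S)).
have h1 : - \sum_(x in S) f x <= \sum_(x in S) `|f x|.
  by rewrite -sumrN; apply: ler_sum => x _; rewrite -normrN ler_norm.
have h2 : \sum_(x | x \notin S) f x <= \sum_(x | x \notin S) `|f x|.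
  by apply: ler_sum => x _; rewrite ler_norm.
by rewrite /N e2; lra.
Qed.

Lemma flux_le (S : {set G}) :
  \sum_(x in S) \sum_(y | y \notin S) (adj x y)%:R * (f y - f x) <= m * N.
Proof.
rewrite lap_flux; under eq_bigr do rewrite lapf.
by rewrite -mulr_sumr -mulrN ler_wpM2l // oppr_sum_le_half.
Qed.

(** Every edge leaving the sublevel set of [f x] goes upwards, so the edges at [x] alone carry at
    most the total flux, and each counted one carries at least [t]. *)
Lemma card_upper_neighbours (t : R) (x : G) : 0 <= t ->
  t * (\sum_y (adj x y && (f x + t < f y)%R))%:R <= m * N.
Proof.
move=> t0; apply: le_trans (flux_le [set z | f z <= f x]%SET).
rewrite [leRHS](bigD1 x) ?inE //= ler_wpDr //.
  apply: sumr_ge0 => z; rewrite inE => /andP[zx _]; apply: sumr_ge0 => y.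
  by rewrite inE -ltNge => xy; rewrite mulr_ge0 // subr_ge0 (le_trans zx) ?ltW.
rewrite natr_sum mulr_sumr big_mkcond [leRHS]big_mkcond /=.
apply: ler_sum => y _; rewrite inE -ltNge; case: ifP => xy.
  case: adj => /=; last by rewrite mulr0 mul0r.
  case: ltP => h; rewrite ?mulr1 ?mul1r ?mulr0; lra.
case: ltP => h; last by rewrite andbF mulr0.
by move/negbT: xy; rewrite -leNgt; lra.
Qed.
End Flow.

(** At most d/4 neighbours of [x] lie more than [t] above it and, by the same bound for -f, at most
    d/4 lie more than [t] below. *)
Lemma card_close_vertices (R : realType) (G : sgraph) (d : nat) (f : G ->
  R) (m t : R) (x : G) :
  regular_graph G d -> 0 <= m -> \sum_x f x = 0 -> (forall x, lap f x = m * f x) ->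
  0 < t -> 4 * (m * (2^-1 * \sum_x `|f x|)) <= t * d%:R ->
  d%:R / 2 <= (\sum_y (`|f y - f x| <= t)%R)%:R :> R.
Proof.
move=> reg m0 f0 lapf t0 tF; set N := 2^-1 * _ in tF.
have up := card_upper_neighbours m0 f0 lapf x (ltW t0).
have fN0 : \sum_x - f x = 0 by rewrite sumrN f0 oppr0.
have lapfN y : lap (fun z => - f z) y = m * - f y.
  rewrite mulrN -lapf /lap -sumrN; apply: eq_bigr => z _; ring.
have := card_upper_neighbours m0 fN0 lapfN x (ltW t0).
under [X in m * (_ * X)]eq_bigr do rewrite normrN.
rewrite -/N in up * => down.
have : (d%:R : R) <= (\sum_y (adj x y && (f x + t < f y)%R))%:R
    + (\sum_y (adj x y && (- f x + t < - f y)%R))%:R + (\sum_y (`|f y - f x| <=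
      t)%R)%:R.
  rewrite -!natrD ler_nat -(regular_degree reg x) -!big_split /=.
  apply: leq_sum => y _; case: adj => //=.
  case: ltP => //= h1; case: ltP => //= h2.
  suff -> : `|f y - f x| <= t by [].
  by rewrite ler_norml; lra.
have h1 : (\sum_y (adj x y && (f x + t < f y)%R))%:R <= d%:R / 4 :> R.
  by rewrite -(ler_pM2l t0); lra.
have h2 : (\sum_y (adj x y && (- f x + t < - f y)%R))%:R <= d%:R / 4 :> R.
  by rewrite -(ler_pM2l t0); lra.
lra.
Qed.

Lemma sum_gaps_window (R : realType) (a : nat -> R) (n : nat) (Q : pred nat) (l u : R) :
  l <= u -> (forall i, (0 < i < n)%N -> a i.-1 <= a i) ->
  (forall i, (0 < i < n)%N -> Q i -> l <= a i.-1 /\ a i <= u) ->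
  \sum_(1 <= i < n | Q i) (a i - a i.-1) <= u - l.
Proof.
(* Clamping to [l, u] leaves the selected gaps unchanged and all gaps nonnegative, so the clamped
   gaps telescope to at most u - l. *)
move=> lu mono win; pose c x := Num.min (Num.max x l) u.
have cl x : l <= c x <= u by rewrite /c le_min ge_min le_max !lexx lu !orbT.
have cmono x y : x <= y -> c x <= c y.
  by move=> xy; rewrite /c le_min2 // le_max2.
case: n mono win => [|n] mono win; first by rewrite big_geq // subr_ge0.
apply: (@le_trans _ _ (c (a n) - c (a 0%N))); last first.
  by have /andP[] := cl (a n); have /andP[] := cl (a 0%N); lra.
have -> : c (a n) - c (a 0%N) = \sum_(1 <= i < n.+1) (c (a i) - c (a i.-1)).
  by rewrite -(telescope_sumr (c \o a)) // big_add1.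
rewrite big_mkcond; apply: ler_sum_nat => i /andP[i0 iN].
have i_n : (0 < i < n.+1)%N by rewrite i0.
case: ifP => [/(win _ i_n)[h1 h2]|_]; last by rewrite subr_ge0 cmono // mono.
have h3 := mono _ i_n.
suff cE x : l <= x <= u -> c x = x by rewrite !cE //; apply/andP; split; lra.
by move=> /andP[lx xu]; rewrite /c max_l // min_l.
Qed.

(** * Prefixes of the vertices sorted by an eigenfunction *)

Lemma sorted_enumeration (R : realType) (G : sgraph) (f : G -> R) : (0 < #|G|)%N ->
  exists (r : G -> nat) (v : nat -> G),
  [/\ forall x, (r x < #|G|)%N, forall x, v (r x) = x,
      forall i, (i < #|G|)%N -> r (v i) = i
    & forall i j, (i <= j < #|G|)%N -> f (v i) <= f (v j)].
Proof.
move=> G0; have x0 : G := enum_val (Ordinal G0).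
pose s := sort (fun x y => f x <= f y) (enum G).
have ss : size s = #|G| by rewrite size_sort cardE.
have us : uniq s by rewrite sort_uniq enum_uniq.
have ms x : x \in s by rewrite mem_sort mem_enum.
exists (index^~ s), (nth x0 s); split => [x|x|i iG|i j /andP[ij jG]].
- by rewrite -ss index_mem.
- by rewrite nth_index.
- by rewrite index_uniq ?ss.
have tr : transitive (fun x y => f x <= f y) by move=> y x z; apply: le_trans.
apply: (sorted_leq_nth tr) => //; rewrite ?inE ?ss //.
- by apply: sort_sorted => x y; apply: le_total.
- exact: leq_ltn_trans jG.
Qed.

Lemma big_prefix (V : Type) (idx : V) (op : Monoid.com_law idx) (G : sgraph)
    (r : G -> nat) (v : nat -> G) (F : G -> V) (i : nat) :
  (forall x, (r x < #|G|)%N) -> (forall x, v (r x) = x) ->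
  (forall j, (j < #|G|)%N -> r (v j) = j) -> (i <= #|G|)%N ->
  \big[op/idx]_(x in [set x | (r x < i)%N]%SET) F x = \big[op/idx]_(0 <= j < i) F (v j).
Proof.
move=> rG vr rv iG; rewrite big_mkord (big_ord_widen _ (fun j => F (v j)) iG).
rewrite (reindex (fun j : 'I_#|G| => v j)) /=.
  by apply: eq_bigl => j; rewrite inE rv.
exists (fun x => Ordinal (rG x)) => [j _|x _] /=; last by rewrite vr.
by apply: val_inj; rewrite /= rv.
Qed.

Section SortedEigenfunction.
Variables (R : realType) (G : sgraph) (d : nat) (f : G -> R) (m : R).
Hypotheses (reg : regular_graph G d) (d_gt0 : (0 < d)%N) (m_gt0 : 0 < m).
Hypotheses (f0 : \sum_x f x = 0) (lapf : forall x, lap f x = m * f x).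
Hypothesis f_neq0 : exists x, f x != 0.
Variables (r : G -> nat) (v : nat -> G).
Hypotheses (rG : forall x, (r x < #|G|)%N) (vr : forall x, v (r x) = x).
Hypothesis rv : forall i, (i < #|G|)%N -> r (v i) = i.
Hypothesis f_sorted : forall i j, (i <= j < #|G|)%N -> f (v i) <= f (v j).
Let n := #|G|.
Let prefix i := [set x | (r x < i)%N]%SET.
Let c i := #|edge_cut (prefix i)|.
Hypothesis cut_gt0 : forall i, (0 < i < n)%N -> (0 < c i)%N.
Let a i := f (v i).
Let M i := - \sum_(0 <= j < i) a j.
Let N := 2^-1 * \sum_x `|f x|.

Lemma prefix_mass i : (i <= n)%N -> M i = - \sum_(x in prefix i) f x.
Proof. by move=> iN; rewrite /M /prefix (big_prefix _ f rG vr rv iN). Qed.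

Lemma card_prefix i : (i <= n)%N -> #|prefix i| = i.
Proof.
move=> iN; rewrite -sum1_card /prefix (big_prefix _ (fun=> 1%N) rG vr rv iN).
by rewrite sum_nat_const_nat muln1 subn0.
Qed.

Lemma total_mass : M n = 0.
Proof.
rewrite prefix_mass // -[RHS]oppr0; congr (- _); rewrite -[RHS]f0.
by apply: eq_bigl => x; rewrite inE rG.
Qed.

Let gap_ge0 i : (0 < i < n)%N -> 0 <= a i - a i.-1.
Proof.
by move=> /andP[i0 iN]; rewrite subr_ge0 f_sorted // leq_pred.
Qed.

(** Each edge across the cut climbs at least the whole gap, and the total flux is [m * M i]. *)
Lemma cut_gap_le i : (0 < i < n)%N -> (c i)%:R * (a i - a i.-1) <= m * M i.
Proof.
move=> /andP[i0 iN]; rewrite prefix_mass ?(ltnW iN) // mulrN mulr_sumr.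
under [X in _ <= - X]eq_bigr do rewrite -lapf.
rewrite -lap_flux /c card_edge_cutE natr_sum mulr_suml; apply: ler_sum => x.
rewrite inE => xi; rewrite natr_sum mulr_suml; apply: ler_sum => y.
rewrite inE -leqNgt => iy; case: adj; rewrite ?mul0r ?mul1r //.
rewrite -[in f y](vr y) -[in f x](vr x) lerB // f_sorted //.
- by rewrite iy rG.
- apply/andP; split; first by rewrite -ltnS prednK.
  by apply: leq_ltn_trans iN; exact: leq_pred.
Qed.

Let M_ge0 i : (0 < i < n)%N -> 0 <= M i.
Proof.
move=> iN; rewrite -(pmulr_rge0 _ m_gt0); apply: le_trans (cut_gap_le iN).
by rewrite mulr_ge0 // gap_ge0.
Qed.

Let M_le i : (i <= n)%N -> M i <= N.
Proof. by move=> iN; rewrite prefix_mass // oppr_sum_le_half. Qed.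

Let sum_f2 : \sum_x f x ^+ 2 = \sum_(0 <= i < n) a i ^+ 2.
Proof.
rewrite -(big_prefix _ (fun x => f x ^+ 2) rG vr rv (leqnn n)).
by apply: eq_bigl => x; rewrite inE rG.
Qed.

Let N_gt0 : 0 < N.
Proof.
have [x fx] := f_neq0; rewrite /N mulr_gt0 ?invr_gt0 // (bigD1 x) //=.
by rewrite ltr_wpDr ?normr_gt0 // sumr_ge0.
Qed.

Let N_sqr : N ^+ 2 <= n%:R / 4 * \sum_x f x ^+ 2.
Proof.
have := sqr_sum_le (index_enum G) (fun x => `|f x|).
under [X in _ <= _ * X]eq_bigr do rewrite real_normK ?num_real //.
have -> : size (index_enum G) = n by rewrite /n cardT enumT.
by rewrite /N exprMn => h; lra.
Qed.

(* Double counting of the pairs formed by a gap and a vertex whose value is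
   close to it: each gap has at least d/2 such vertices, and the gaps close to a
   given vertex lie in a window of length 3t. *)
Lemma sum_high_gaps :
  \sum_(1 <= i < n | ~~ (2 * c i < d)%N) (a i - a i.-1) <=
    24 * n%:R * (m * N) / d%:R ^+ 2.
Proof.
have d0 : 0 < d%:R :> R by rewrite ltr0n.
pose t := 4 * (m * N) / d%:R.
have mN0 : 0 < m * N by rewrite mulr_gt0.
have t0 : 0 < t by rewrite /t divr_gt0 // mulr_gt0.
have td : 4 * (m * N) = t * d%:R by rewrite /t divfK // gt_eqF.
have small i : (0 < i < n)%N -> ~~ (2 * c i < d)%N -> a i - a i.-1 <= t.
  move=> iN; rewrite -leqNgt => dc; have g0 := gap_ge0 iN.
  have h1 := cut_gap_le iN.
  have h2 : m * M i <= m * N by rewrite ler_pM2l // M_le //; case/andP: iN => _ /ltnW.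
  have h3 : d%:R <= 2 * (c i)%:R :> R by rewrite -natrM ler_nat.
  have h4 : d%:R * (a i - a i.-1) <= 2 * (c i)%:R * (a i - a i.-1) by rewrite ler_wpM2r.
  have h5 : d%:R * (a i - a i.-1) <= d%:R * t by lra.
  by rewrite -(ler_pM2l d0).
have close i : d%:R / 2 <= (\sum_y (`|f y - a i| <= t)%R)%:R :> R.
  by apply: (card_close_vertices _ reg (ltW m_gt0) f0 lapf t0); rewrite td.
suff : d%:R / 2 * \sum_(1 <= i < n | ~~ (2 * c i < d)%N) (a i - a i.-1) <=
  n%:R * (3 * t).
  move=> h; rewrite -(ler_pM2l (_ : 0 < d%:R / 2)) ?divr_gt0 //.
  apply: le_trans h _; rewrite /t le_eqVlt; apply/orP; left; apply/eqP.
  by field; rewrite gt_eqF.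
apply: (@le_trans _ _ (\sum_(1 <= i < n | ~~ (2 * c i < d)%N)
   (\sum_y (`|f y - a i| <= t)%R)%:R * (a i - a i.-1))).
  rewrite mulr_sumr big_nat_cond [leRHS]big_nat_cond.
  by apply: ler_sum => i /andP[iN _]; rewrite ler_wpM2r // gap_ge0.
rewrite (eq_bigr (fun i => \sum_y (`|f y - a i| <= t)%R%:R * (a i - a i.-1)));
  last first.
  by move=> i _; rewrite natr_sum mulr_suml.
rewrite exchange_big /=.
have -> : n%:R * (3 * t) = \sum_(y : G) 3 * t by rewrite sumr_const mulr_natl.
apply: ler_sum => y _.
have window : \sum_(1 <= i < n | ~~ (2 * c i < d)%N && (`|f y - a i| <=
  t)) (a i - a i.-1) <= 3 * t.
  (* The upper end of the gap is within [t] of [f y], and a high gap has length at most [t]. *)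
  have -> : 3 * t = f y + t - (f y - 2 * t) by ring.
  apply: sum_gaps_window => [|i iN|i iN /andP[high]]; first by lra.
    by rewrite -subr_ge0 gap_ge0.
  by rewrite ler_norml => /andP[h1 h2]; have := small i iN high; split; lra.
apply: le_trans window.
rewrite big_mkcondr; apply: ler_sum => i _.
by case: ifP => _; rewrite ?mul1r ?mul0r.
Qed.

(** Summation by parts, split by the size of the cut. Low gaps are bounded by [cut_gap_le]; for the
    others [M i <= N] and [sum_high_gaps] apply, and the 6 is 24 times the 1/4 of [N_sqr]. *)
Lemma low_cut_energy :
  (1 - 6 * n%:R ^+ 2 * m / d%:R ^+ 2) * \sum_x f x ^+ 2 <=
  m * \sum_(1 <= i < n | (2 * c i < d)%N) M i ^+ 2 / (c i)%:R.
Proof.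
have d0 : 0 < d%:R :> R by rewrite ltr0n.
have n0 : (0 < n)%N by have [x _] := f_neq0; apply: leq_ltn_trans (rG x).
have parts : \sum_x f x ^+ 2 = \sum_(1 <= i < n) M i * (a i - a i.-1).
  by rewrite sum_f2 -(prednK n0); apply: sum_sqr_by_parts; rewrite prednK //;
    exact: total_mass.
have low : \sum_(1 <= i < n | (2 * c i < d)%N) M i * (a i - a i.-1) <=
    m * \sum_(1 <= i < n | (2 * c i < d)%N) M i ^+ 2 / (c i)%:R.
  rewrite mulr_sumr big_nat_cond [leRHS]big_nat_cond.
  apply: ler_sum => i /andP[iN _].
  have c0 : 0 < (c i)%:R :> R by rewrite ltr0n cut_gt0.
  have -> : m * (M i ^+ 2 / (c i)%:R) = M i * (m * M i / (c i)%:R) by ring.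
  by rewrite ler_wpM2l ?M_ge0 // ler_pdivlMr // mulrC cut_gap_le.
have high : \sum_(1 <= i < n | ~~ (2 * c i < d)%N) M i * (a i - a i.-1) <=
    6 * n%:R ^+ 2 * m / d%:R ^+ 2 * \sum_x f x ^+ 2.
  apply: (@le_trans _ _ (N * (24 * n%:R * (m * N) / d%:R ^+ 2))).
    apply: le_trans (ler_wpM2l (ltW N_gt0) sum_high_gaps).
    rewrite mulr_sumr big_nat_cond [leRHS]big_nat_cond.
    apply: ler_sum => i /andP[iN _]; rewrite ler_wpM2r ?gap_ge0 // M_le //.
    by case/andP: iN => _ /ltnW.
  have -> : N * (24 * n%:R * (m * N) / d%:R ^+ 2) = 24 * n%:R * m / d%:R ^+ 2 * N ^+
    2 by ring.
  have -> : 6 * n%:R ^+ 2 * m / d%:R ^+ 2 * \sum_x f x ^+ 2 =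
    24 * n%:R * m / d%:R ^+ 2 * (n%:R / 4 * \sum_x f x ^+ 2) by field; rewrite gt_eqF.
  by rewrite ler_wpM2l ?N_sqr // divr_ge0 ?sqr_ge0 // mulr_ge0 ?(ltW m_gt0).
have split : \sum_x f x ^+ 2 = \sum_(1 <= i < n | (2 * c i < d)%N) M i * (a i - a i.-1)
   + \sum_(1 <= i < n | ~~ (2 * c i < d)%N) M i * (a i - a i.-1).
  by rewrite parts (bigID (fun i => (2 * c i < d)%N)).
by rewrite mulrBl mul1r; lra.
Qed.

Let low i := (2 * c i < d)%N.
Let lows := [seq i <- index_iota 1 n | low i].

(** The shell between two low prefixes has a cut below d/2 + d/2, hence more than [d] vertices. The
    ends 0 and [n] count as low because their cuts are empty. *)
Lemma low_cuts_far : path (fun p q => (p + d <= q)%N) 0 (rcons lows n).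
Proof.
have n0 : (0 < n)%N by have [x _] := f_neq0; apply: leq_ltn_trans (rG x).
have low0 : low 0.
  by rewrite /low /c card_edge_cutE big1 // => x; rewrite inE ltn0.
have lown : low n.
  by rewrite /low /c -card_edge_cutC card_edge_cutE big1 // => x; rewrite !inE rG.
have E : 0%N :: rcons lows n = [seq i <- iota 0 n.+1 | low i].
  have -> : iota 0 n.+1 = 0%N :: rcons (index_iota 1 n) n.
    rewrite /index_iota subn1 -[LHS]/(0%N :: iota 1 n); congr cons.
    by case: (n) n0 => // k _; rewrite -[in LHS](addn1 k) iotaD add1n -cats1.
  by rewrite /= low0 filter_rcons lown.
have : sorted ltn (0%N :: rcons lows n).
  by rewrite E; apply: sorted_filter; [exact: ltn_trans|exact: iota_ltn_sorted].
rewrite /=; apply: (sub_in_path (P := fun i => low i && (i <= n)%N)).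
- move=> i j /andP[li iN] /andP[lj jN] /= ij.
  have card : #|(prefix j :\: prefix i)%SET| = (j - i)%N.
    rewrite cardsD (finset.setIidPr _) ?card_prefix //.
    by apply/fintype.subsetP => x; rewrite !inE => /ltn_trans; apply.
  have : (d < #|(prefix j :\: prefix i)%SET|)%N.
    apply: (regular_small_cut reg).
      by rewrite -card_gt0 card subn_gt0.
    by apply: leq_ltn_trans (card_edge_cutD _ _) _; move: li lj;
      rewrite /low -/(c i) -/(c j); lia.
  by rewrite card; lia.
- by rewrite E; apply/allP => i; rewrite mem_filter mem_iota /= add0n ltnS.
Qed.

End SortedEigenfunction.

(** * The lower bound for a single graph *)

Lemma edge_connectivity_gt0 (G : sgraph) (d : nat) :
  regular_graph G d -> (0 < edge_connectivity G)%N -> (0 < d)%N /\ (1 < #|G|)%N.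
Proof.
move=> reg; rewrite lt0n => ec.
(* The number of edges bounds the edge-connectivity, so an edge exists; this excludes degree 0 and a
   single vertex. *)
have [x [y xy]] : exists x : G, exists y : G, adj x y.
  apply: contrapT => noadj; case/eqP: ec; apply/eqP; rewrite -leqn0.
  apply: leq_trans (edge_connectivity_le_edges G) _; rewrite leqn0 cards_eq0.
  apply/eqP/setP => e; rewrite [RHS]inE; apply/imset2P => -[x y _].
  by rewrite !inE /= => xy _; apply: noadj; exists x, y.
split; first by rewrite -(regular_degree reg x) (bigD1 y) //= xy.
rewrite (cardD1 x) (cardD1 y) !inE /=; case: eqVneq => // yx.
by move: xy; rewrite yx adj_irrefl.
Qed.

(** The first alternative comes from exactly one low cut, the second from several or none. Bounding
    1 by a multiple of X makes the error 6/d of the high gaps additive. *)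
Lemma gap_dichotomy (R : realType) (G : sgraph) (d k : nat) :
  connected_graph G -> regular_graph G d -> (0 < k)%N -> (k <= edge_connectivity G)%N ->
  let n : R := #|G|%:R in
  let X := n ^+ 2 * spectral_gap R G d in
  (exists S : {set G},
    [/\ proper_vertex_set S, (k <= #|edge_cut S|)%N, (d < #|S|)%N, (d < #|(~: S)%SET|)%N
      & 1 <= X * (d%:R * (#|S|%:R * #|(~: S)%SET|%:R) / (n ^+ 3 * #|edge_cut S|%:R) +
        6 / d%:R)])
  \/ 1 <= X * ((8 * (101 / 100) * k%:R)^-1 + 6 / d%:R).
Proof.
move=> conG reg k0 kG n X.
have [d0 G1] := edge_connectivity_gt0 reg (leq_trans k0 kG).
have [f [f_neq0 f0 m0 lapf]] := mu_eigenfunction R conG G1.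
set m := mu R G in m0 lapf.
have [r [v [rG vr rv f_sorted]]] := sorted_enumeration f (ltnW G1).
pose prefix i := [set x | (r x < i)%N]%SET.
have cardp i : (i <= #|G|)%N -> #|prefix i| = i by move=> iN;
  exact: (card_prefix rG vr rv iN).
have cut_k i : (0 < i < #|G|)%N -> (k <= #|edge_cut (prefix i)|)%N.
  move=> /andP[i0 iN]; apply: leq_trans kG (edge_connectivity_le _).
  rewrite /proper_vertex_set -card_gt0 cardp ?(ltnW iN) // i0 /=.
  by apply/eqP => /(congr1 (fun A : {set G} => #|A|));
    rewrite cardp ?(ltnW iN) // cardsT; lia.
have cut_gt0 i (iN : (0 < i < #|G|)%N) := leq_trans k0 (cut_k i iN).
have energy := low_cut_energy reg d0 m0 f0 lapf f_neq0 rG vr rv f_sorted cut_gt0.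
have far := low_cuts_far reg d0 m0 f_neq0 rG vr rv.
have Mn := total_mass f0 rG vr rv.
have sum_f2 : \sum_(0 <= i < #|G|) f (v i) ^+ 2 = \sum_x f x ^+ 2.
  rewrite -(big_prefix _ (fun x => f x ^+ 2) rG vr rv (leqnn _)).
  by apply: eq_bigl => x; rewrite inE rG.
set Q := \sum_x f x ^+ 2 in energy sum_f2.
have Q0 : 0 < Q.
  have [x fx] := f_neq0; rewrite /Q (bigD1 x) //= ltr_wpDr //.
    by apply: sumr_ge0 => y _; apply: sqr_ge0.
  by rewrite exprn_even_gt0.
have d0' : 0 < d%:R :> R by rewrite ltr0n.
have n0 : 0 < n by rewrite ltr0n ltnW.
have k0' : 0 < k%:R :> R by rewrite ltr0n.
have XE : X = n ^+ 2 * (m / d%:R) by [].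
have X0 : 0 < X by rewrite XE mulr_gt0 ?exprn_gt0 ?divr_gt0.
have mE : m = X * d%:R / n ^+ 2 by rewrite XE; field; rewrite !gt_eqF.
have E6 : 6 * n ^+ 2 * m / d%:R ^+ 2 = X * (6 / d%:R) by rewrite XE; field;
  rewrite gt_eqF.
rewrite -big_filter -/n E6 in energy.
rewrite -/prefix in far energy.
set lows := [seq i <- _ | _] in far energy.
have lowsP i : i \in lows -> (0 < i < #|G|)%N /\ (2 * #|edge_cut (prefix i)| < d)%N.
  by rewrite mem_filter mem_index_iota => /andP[h1 h2]; split.
case: (ltnP 1 (size lows)) => [lows2|].
- right.
  pose phi (x : nat) : R := quartic (x%:R / n).
  have phi_gt0 q : (0 < q < #|G|)%N -> 0 < phi q.
    move=> /andP[q0 qn]; have t0 : 0 < q%:R / n by rewrite divr_gt0 // ltr0n.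
    have t1 : q%:R / n < 1 by rewrite ltr_pdivrMr // mul1r ltr_nat.
    by rewrite /phi /quartic ltr_wpDr ?divr_ge0 ?sqr_ge0 // mulr_gt0 // subr_gt0.
  have phi0 : phi 0%N = 0 by rewrite /phi /quartic mul0r; ring.
  have phin : phi #|G| = 0 by rewrite /phi /quartic divff ?gt_eqF //; ring.
  have h := hardy Mn d0 phi0 phin phi_gt0 (fun p q r =>
    @scaled_quartic_supersolution R #|G| d p q r d0) far lows2.
  rewrite sum_f2 -/n in h.
  set M2 := \sum_(x <- lows) _ in h.
  have M2_ge0 : 0 <= M2 by apply: sumr_ge0 => i _; apply: sqr_ge0.
  have : (1 - X * (6 / d%:R)) * Q <= m * (M2 / k%:R).
    apply: le_trans energy _; rewrite ler_pM2l // /M2 mulr_suml big_seq [leRHS]big_seq.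
    apply: ler_sum => i /lowsP[iN _]; rewrite ler_wpM2l ?sqr_ge0 //.
    by rewrite lef_pV2 ?posrE ?ltr0n ?cut_gt0 // ler_nat cut_k.
  have -> : m * (M2 / k%:R) = X * (8 * (101 / 100) * k%:R)^-1 * (8 * d%:R / n ^+ 2 *
    (101 / 100) * M2).
    by rewrite mE; field; rewrite !gt_eqF.
  move=> /le_trans /(_ (ler_wpM2l _ h)); rewrite -(ler_pM2r Q0) mul1r.
  have : 0 <= X * (8 * (101 / 100) * k%:R)^-1
    by rewrite mulr_ge0 ?invr_ge0 ?mulr_ge0 // ltW.
  by move=> + H => /H; lra.
case El : lows => [|q [|//]] _.
  (* Without low cuts already 1 <= X * 6/d. *)
  right; rewrite El big_nil mulr0 in energy.
  have : (1 - X * (6 / d%:R)) <= 0 by rewrite -(pmulr_lle0 _ Q0).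
  have : 0 <= X * (8 * (101 / 100) * k%:R)^-1
    by rewrite mulr_ge0 ?invr_ge0 ?mulr_ge0 // ltW.
  by lra.
left; have [qN lowq] : (0 < q < #|G|)%N /\ (2 * #|edge_cut (prefix q)| < d)%N.
  by apply: lowsP; rewrite El mem_head.
have /andP[q0 qn] := qN.
have cq := cardp q (ltnW qn).
have cqC : #|(~: prefix q)%SET| = (#|G| - q)%N by rewrite cardsCs finset.setCK cq.
exists (prefix q); split.
- rewrite /proper_vertex_set -card_gt0 cq q0 /=.
  by apply/eqP => /(congr1 (fun A : {set G} => #|A|)); rewrite cq cardsT; lia.
- exact: cut_k.
- by apply: (regular_small_cut reg); [rewrite -card_gt0 cq | lia].
- apply: (regular_small_cut reg); first by rewrite -card_gt0 cqC subn_gt0.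
  by rewrite card_edge_cutC; lia.
rewrite cq cqC natrB ?(ltnW qn) // -/n.
have c0 : 0 < #|edge_cut (prefix q)|%:R :> R by rewrite ltr0n cut_gt0.
have h := hardy_one Mn qN.
rewrite sum_f2 -/n in h.
rewrite El big_seq1 in energy.
set M2 := (_ ^+ 2) in energy h; rewrite -/M2 in h.
set c := #|edge_cut (prefix q)|%:R in energy c0 *.
have : m * (M2 / c) <= X * (d%:R * (q%:R * (n - q%:R)) / (n ^+ 3 * c)) * Q.
  have -> : m * (M2 / c) = X * d%:R / (n ^+ 3 * c) * (n * M2) by rewrite mE; field;
    rewrite !gt_eqF.
  have -> : X * (d%:R * (q%:R * (n - q%:R)) / (n ^+ 3 * c)) * Q =
     X * d%:R / (n ^+ 3 * c) * (q%:R * (n - q%:R) * Q) by field; rewrite !gt_eqF.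
  by rewrite ler_wpM2l // divr_ge0 ?mulr_ge0 ?exprn_ge0 // ltW.
move=> /(le_trans energy); rewrite -(ler_pM2r Q0) mul1r; lra.
Qed.

(** * Asymptotics *)

(** The centred indicator of [S] has energy equal to the size of the cut and squared norm |S| |~S| /
    n. *)
Lemma mu_le_cut (R : realType) (G : sgraph) (S : {set G}) :
  connected_graph G -> proper_vertex_set S ->
  mu R G * (#|S|%:R * #|(~: S)%SET|%:R) <= #|edge_cut S|%:R * #|G|%:R.
Proof.
move=> conG /andP[S0 ST].
have s0 : (0 < #|S|)%N by rewrite card_gt0.
have sN : (#|S| < #|G|)%N.
  by rewrite ltn_neqAle max_card andbT -cardsT; apply: contra ST => /eqP e;
    rewrite eqEcard finset.subsetT e leqnn.
have n0 : 0 < #|G|%:R :> R by rewrite ltr0n (leq_ltn_trans _ sN).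
pose s : R := #|S|%:R; pose n : R := #|G|%:R.
pose h (x : G) : R := (x \in S)%:R - s / n.
have sumS : \sum_x (x \in S)%:R = s :> R.
  by rewrite /s -sum1_card natr_sum [RHS]big_mkcond; apply: eq_bigr => x _;
    case: (x \in S).
have h0 : \sum_x h x = 0.
  by rewrite sumrB sumS sumr_const -[_ *+ _]mulr_natl -/n; field; rewrite gt_eqF.
have := mu_rayleigh conG (leq_ltn_trans s0 sN) h0.
have -> : \sum_x h x ^+ 2 = s * #|(~: S)%SET|%:R / n.
  have -> : \sum_x h x ^+ 2 = \sum_x ((x \in S)%:R * (1 - 2 * (s / n)) + (s / n) ^+ 2).
    by apply: eq_bigr => x _; rewrite /h; case: (x \in S) => /=; ring.
  rewrite big_split /= -mulr_suml sumS sumr_const -[_ *+ _]mulr_natl -/n.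
  have -> : #|(~: S)%SET|%:R = n - s by rewrite cardsCs finset.setCK natrB // ltnW.
  by field; rewrite gt_eqF.
have -> : \sum_x h x * lap h x = #|edge_cut S|%:R.
  rewrite sum_lapM.
  have -> : \sum_x \sum_y (adj x y)%:R * ((h x - h y) * (h x - h y)) =
     (#|edge_cut S| + #|edge_cut (~: S)%SET|)%:R :> R.
    rewrite !card_edge_cut_pairs -big_split natr_sum; apply: eq_bigr => x _ /=.
    rewrite -big_split natr_sum; apply: eq_bigr => y _ /=.
    by rewrite /h !inE; case: (x \in S); case: (y \in S); case: adj => /=; ring.
  by rewrite card_edge_cutC natrD; field.
by rewrite mulrA ler_pdivrMr // -/s mulrA.
Qed.

Lemma le_limn_einf (R : realType) (u w : nat -> R) (l : R) :
  (forall m, u m <= w m) -> (u @ \oo --> l)%classic ->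
    (l%:E <= limn_einf (EFin \o w))%E.
Proof.
move=> uw ul.
have ul' : ((EFin \o u) @ \oo --> l%:E)%classic.
  by apply: cvg_EFin => //; apply: nearW.
rewrite -(cvg_limn_einf_sup ul').1 !limn_einf_lim.
apply: lee_lim; [exact: is_cvg_einfs|exact: is_cvg_einfs|apply: nearW => m].
apply: le_ereal_inf_tmp => _ [p /= mp <-].
apply: (@le_trans _ _ (u p)%:E); last by rewrite lee_fin.
by apply: ereal_inf_lbound; exists p.
Qed.

Lemma admissible_gt0 k G d m : (0 < k)%N -> admissible k G d ->
  (0 < d m)%N /\ (1 < #|G m|)%N.
Proof.
by move=> k0 [_ /(_ m)[_ reg kG]]; apply: edge_connectivity_gt0 reg (leq_trans k0 kG).
Qed.

Lemma admissible_degree_inv (R : realType) k G d : (0 < k)%N -> admissible k G d ->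
  ((fun m => (d m)%:R^-1 : R) @ \oo --> (0 : R))%classic.
Proof.
move=> k0 adm; have [dinf _] := adm.
apply/gtr0_cvgV0; first by apply: nearW => m; rewrite ltr0n (admissible_gt0 m k0 adm).1.
exact: (cvg_comp _ _ dinf (@cvgr_idn R)).
Qed.

Lemma mul_sides_le (R : realType) (G : sgraph) (S : {set G}) :
  #|S|%:R * #|(~: S)%SET|%:R <= #|G|%:R ^+ 2 / 4 :> R.
Proof.
rewrite -(cardsC S) natrD; set a := #|S|%:R; set b := #|_|%:R.
rewrite -subr_ge0.
have -> : (a + b) ^+ 2 / 4 - a * b = ((a - b) / 2) ^+ 2 by field.
exact: sqr_ge0.
Qed.

Section Asymptotics.
Variables (R : realType) (k : nat) (G : nat -> sgraph) (d : nat -> nat).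
Hypotheses (k0 : (0 < k)%N) (adm : admissible k G d).
Let X := scaled_gap R G d.
Let n m : R := #|G m|%:R.
Let dR m : R := (d m)%:R.

Let d0 m : 0 < dR m. Proof. by rewrite ltr0n (admissible_gt0 m k0 adm).1. Qed.
Let n0 m : 0 < n m. Proof. by rewrite ltr0n (ltnW (admissible_gt0 m k0 adm).2). Qed.
Let k0' : 0 < k%:R :> R. Proof. by rewrite ltr0n. Qed.

(** The first alternative of [gap_dichotomy], as a predicate from which cuts can be chosen along the
    sequence. *)
Definition balanced_cut m (S : {set G m}) : Prop :=
  [/\ proper_vertex_set S, (k <=
    #|edge_cut S|)%N, (d m < #|S|)%N, (d m < #|(~: S)%SET|)%N
    & 1 <= X m * (dR m * (#|S|%:R * #|(~: S)%SET|%:R) / (n m ^+ 3 * #|edge_cut S|%:R)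
      + 6 / dR m)].

Lemma balanced_cutP m : (exists S : {set G m}, balanced_cut S) \/
  1 <= X m * ((8 * (101 / 100) * k%:R)^-1 + 6 / dR m).
Proof.
by have [_ /(_ m)[con reg kG]] := adm; apply: gap_dichotomy con reg k0 kG.
Qed.

Let X_gt0 m : 0 < X m.
Proof.
have [_ /(_ m)[con _ _]] := adm.
have [f [_ _ mu0 _]] := mu_eigenfunction R con (admissible_gt0 m k0 adm).2.
apply: mulr_gt0; first by apply: exprn_gt0; exact: n0.
by apply: divr_gt0 => //; exact: d0.
Qed.

(** Used with [j = k] for lower bounds and with [j = k.+1] to exclude larger cuts. *)
Lemma balanced_cut_le m (S : {set G m}) (j : nat) : (0 < j)%N ->
  (j <= #|edge_cut S|)%N ->
  balanced_cut S -> 1 <= X m * (dR m / n m / (4 * j%:R) + 6 / dR m).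
Proof.
move=> j0 jc [_ _ _ _] /le_trans; apply; rewrite ler_pM2l ?X_gt0 // lerD2r.
have nm := n0 m; have dm := d0 m.
have j0' : 0 < j%:R :> R by rewrite ltr0n.
have c0 : 0 < #|edge_cut S|%:R :> R by rewrite ltr0n (leq_trans j0 jc).
have cj : j%:R <= #|edge_cut S|%:R :> R by rewrite ler_nat.
have -> : dR m / n m / (4 * j%:R) = dR m * (n m ^+ 2 / 4) / (n m ^+ 3 * j%:R).
  by field; rewrite !gt_eqF.
have n3 : 0 < n m ^+ 3 by apply: exprn_gt0; exact: n0.
apply: ler_pM.
- by rewrite !mulr_ge0 // ltW // d0.
- by rewrite invr_ge0 mulr_ge0 // ltW.
- by rewrite ler_pM2l ?d0 //; exact: mul_sides_le.
- by rewrite lef_pV2 ?posrE ?mulr_gt0 // ler_pM2l.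
Qed.

Lemma balanced_cut_half m (S : {set G m}) : balanced_cut S -> dR m / n m <= 2^-1.
Proof.
have nm := n0 m; move=> [_ _ h1 h2 _]; rewrite ler_pdivrMr // /n -(cardsC S) natrD.
have h3 : dR m <= #|S|%:R by rewrite ler_nat ltnW.
have h4 : dR m <= #|(~: S)%SET|%:R by rewrite ler_nat ltnW.
lra.
Qed.

Let dinv := @admissible_degree_inv R k G d k0 adm.

Let cvg_correction (b : R) : ((fun m => b + 6 / dR m) @ \oo --> b)%classic.
Proof.
rewrite -[X in _ --> X]addr0 -[X in _ + X](mulr0 6).
by apply: cvgD; [exact: cvg_cst|apply: cvgM; [exact: cvg_cst|exact: dinv]].
Qed.

(** A balanced cut has d/n <= 1/2, which turns 1/(4k) into 1/(8k); the other alternative is stronger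
    by the factor 101/100. *)
Lemma scaled_gap_ge m : (8^-1 / k%:R + 6 / dR m)^-1 <= X m.
Proof.
have dm := d0 m; have xm := X_gt0 m; have kk := k0'.
have q0 : 0 < 8^-1 / k%:R + 6 / dR m by rewrite addr_gt0 ?divr_gt0 ?mulr_gt0 ?invr_gt0.
rewrite -(ler_pM2r q0) mulVf ?gt_eqF //.
case: (balanced_cutP m) => [[S HS]|/le_trans]; last first.
  apply; rewrite ler_pM2l // lerD2r -invfM lef_pV2 ?posrE ?mulr_gt0 //; lra.
have [_ kc _ _ _] := HS.
apply: le_trans (balanced_cut_le k0 kc HS) _; rewrite ler_pM2l // lerD2r.
have := balanced_cut_half HS => h.
have -> : 8^-1 / k%:R = 2^-1 / (4 * k%:R) :> R by field; rewrite gt_eqF.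
by rewrite ler_pM2r // invr_gt0 mulr_gt0.
Qed.

Lemma cvg_gap_lower_bound :
  ((fun m => (8^-1 / k%:R + 6 / dR m)^-1) @ \oo --> ((8 * k)%:R : R))%classic.
Proof.
have -> : (8 * k)%:R = (8^-1 / k%:R)^-1 :> R by rewrite natrM; field; rewrite gt_eqF.
by apply: cvgV; [rewrite mulf_neq0 ?invr_eq0 ?gt_eqF|exact: cvg_correction].
Qed.

(** A squeeze between [scaled_gap_ge] and [mu_le_cut]. With s and t the sizes of the sides over d,
    the upper bound is k (s + t)^3 / (s t), which tends to 8k. *)
Lemma scaled_gap_cvg_of_cut (S : forall m, {set G m}) :
  (\forall m \near \oo, proper_vertex_set (S m) /\ #|edge_cut (S m)| = k) ->
  (fun m => #|S m|%:R : R) = dR +o_\oo dR ->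
  (fun m => #|(~: S m)%SET|%:R : R) = dR +o_\oo dR ->
  (X @ \oo --> ((8 * k)%:R : R))%classic.
Proof.
move=> cutS oS oSC.
have ratio (u : nat -> R) : u = dR +o_\oo dR ->
  ((fun m => u m / dR m) @ \oo --> (1 : R))%classic.
  move=> /eqaddoP ou; apply/cvgrPdist_le => e e0; apply: filterS (ou e e0) => m.
  have dm := d0 m.
  move=> um0; have um : `|u m - dR m| <= e * `|dR m| := um0.
  have -> : 1 - u m / dR m = - ((u m - dR m) / dR m) by field; rewrite gt_eqF.
  by rewrite normrN normrM normfV (gtr0_norm dm) ler_pdivrMr // -{2}(gtr0_norm dm).
have r1 := ratio _ oS; have r2 := ratio _ oSC.
pose s m : R := #|S m|%:R / dR m; pose t m : R := #|(~: S m)%SET|%:R / dR m.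
have st : ((fun m => k%:R * (s m +
  t m) ^+ 3 / (s m * t m)) @ \oo --> ((8 * k)%:R : R))%classic.
  have -> : (8 * k)%:R = k%:R * (1 + 1) ^+ 3 / (1 * 1) :> R by rewrite natrM; field.
  have stD : ((fun m => s m + t m) @ \oo --> (1 + 1 : R))%classic by apply: cvgD.
  apply: cvgM; last by apply: cvgV; [rewrite mulr1 oner_eq0|apply: cvgM].
  apply: cvgM; first exact: cvg_cst.
  exact: (cvgM stD (cvgM stD stD)).
apply: (squeeze_cvgr _ cvg_gap_lower_bound st).
apply: filterS cutS => m [PS cS]; have nm := n0 m; have dm := d0 m.
 rewrite scaled_gap_ge /=.
have [_ /(_ m)[con _ _]] := adm.
have := mu_le_cut R con PS; rewrite cS -/(n m).
have /andP[S0 ST] := PS.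
have s0 : 0 < #|S m|%:R :> R by rewrite ltr0n card_gt0.
have t0 : 0 < #|(~: S m)%SET|%:R :> R.
  by rewrite ltr0n card_gt0; apply: contra ST => /eqP e;
    rewrite -[S m]finset.setCK e finset.setC0.
have nE : n m = #|S m|%:R + #|(~: S m)%SET|%:R by rewrite -natrD cardsC.
rewrite /X /scaled_gap /spectral_gap -/(n m) -/(dR m) /s /t.
move: (mu R (G m)) nE s0 t0 => mu nE; set a := #|S m|%:R in nE *;
  set b := #|_|%:R in nE *.
move=> a0 b0 h.
have -> : k%:R * (a / dR m + b / dR m) ^+ 3 / (a / dR m * (b / dR m)) =
   n m ^+ 2 / dR m * ((k%:R * n m) / (a * b)) by rewrite nE; field; rewrite !gt_eqF.
have -> : n m ^+ 2 * (mu / dR m) = n m ^+ 2 / dR m * mu by ring.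
by rewrite ler_pM2l ?divr_gt0 ?exprn_gt0 // ler_pdivlMr // mulr_gt0.
Qed.

(** A limit 8k eventually excludes the second alternative, as 100/101 < 1, and cuts of more than k
    edges, as k/(k+1) < 1. The remaining bound gives n <= (2 + o(1)) d, while each side has more
    than d vertices. *)
Lemma cut_of_scaled_gap_cvg : (X @ \oo --> ((8 * k)%:R : R))%classic ->
  exists S : forall m, {set G m},
  [/\ \forall m \near \oo, proper_vertex_set (S m) /\ #|edge_cut (S m)| = k,
      (fun m => #|S m|%:R : R) = dR +o_\oo dR
    & (fun m => #|(~: S m)%SET|%:R : R) = dR +o_\oo dR].
Proof.
move=> XC; pose S m := xget (finset.set0 : {set G m}) [set S : {set G m} |
  balanced_cut S].
have k1 : 0 < k.+1%:R :> R by rewrite ltr0n.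
have far_lt (b : R) : (8 * k)%:R * b < 1 ->
    \forall m \near \oo, X m * (b + 6 / dR m) < 1.
  by move=> b1; apply: cvgr_lt b1; apply: cvgM => //; exact: cvg_correction.
have good : \forall m \near \oo, balanced_cut (S m) /\ #|edge_cut (S m)| = k.
  have h1 : (8 * k)%:R * (8 * (101 / 100) * k%:R)^-1 < 1 :> R.
    have -> : (8 * k)%:R * (8 * (101 / 100) * k%:R)^-1 = 100 / 101 :> R.
      by rewrite natrM; field; rewrite gt_eqF.
    lra.
  have h2 : (8 * k)%:R * (2^-1 / (4 * k.+1%:R)) < 1 :> R.
    have -> : (8 * k)%:R * (2^-1 / (4 * k.+1%:R)) = k%:R / k.+1%:R :> R.
      by rewrite natrM; field; rewrite gt_eqF.
    by rewrite ltr_pdivrMr // mul1r ltr_nat.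
  apply: filterS2 (far_lt _ h1) (far_lt _ h2) => m f1 f2; have xm := X_gt0 m.
  have HS : balanced_cut (S m).
    apply: (xgetPex (finset.set0 : {set G m})); case: (balanced_cutP m) => //.
    by rewrite leNgt f1.
  split=> //; have [_ kc _ _ _] := HS.
  apply/eqP; rewrite eqn_leq kc andbT leqNgt; apply/negP => ck.
  have := balanced_cut_le (ltn0Sn k) ck HS.
  apply/negP; rewrite -ltNge; apply: le_lt_trans f2.
  rewrite ler_pM2l // lerD2r ler_pM2r ?invr_gt0 ?mulr_gt0 //.
  exact: balanced_cut_half HS.
(* [balanced_cut_le] with j = k, solved for d/n, makes this sequence a lower bound of d/n. *)
have wc : ((fun m => 4 * k%:R * ((X m)^-1 - 6 / dR m)) @ \oo --> (2^-1 : R))%classic.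
  have -> : 2^-1 = 4 * k%:R * (((8 * k)%:R)^-1 - 6 * 0) :> R.
    by rewrite natrM; field; rewrite gt_eqF.
  apply: cvgM; first exact: cvg_cst.
  apply: cvgB; last by apply: cvgM; [exact: cvg_cst|exact: dinv].
  by apply: cvgV => //; rewrite pnatr_eq0 muln_eq0 /= -lt0n.
have order_le (e : R) : 0 < e -> \forall m \near \oo, n m <= (2 + e) * dR m.
  move=> e0; have e2 : (2 + e)^-1 < 2^-1 by rewrite ltf_pV2 ?posrE; lra.
  have w1 : \forall m \near \oo, (2 + e)^-1 < 4 * k%:R * ((X m)^-1 - 6 / dR m).
    by apply: cvgr_gt e2; exact: wc.
  apply: filterS2 w1 good => m w [HS cS].
  have nm := n0 m; have dm := d0 m; have xm := X_gt0 m; have kk := k0'.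
  have := balanced_cut_le k0 (eq_leq (esym cS)) HS.
  rewrite -ler_pdivrMl // mulr1 -lerBlDr ler_pdivlMr ?mulr_gt0 //.
  rewrite [_ * (4 * _)]mulrC => /(lt_le_trans w).
  rewrite ltr_pdivlMr // ltr_pdivrMl; last by lra.
  by move=> /ltW.
exists S; split.
- by apply: filterS good => m [[PS _ _ _ _] cS].
- apply/eqaddoP => e e0; apply: filterS2 (order_le e e0) good => m nd [[_ _ h1 h2 _] _].
  rewrite -[(_ - dR) m]/(#|S m|%:R - dR m) (gtr0_norm (d0 m)).
  have h3 : dR m <= #|S m|%:R by rewrite ler_nat ltnW.
  have h4 : dR m <= #|(~: S m)%SET|%:R by rewrite ler_nat ltnW.
  have nE : n m = #|S m|%:R + #|(~: S m)%SET|%:R by rewrite -natrD cardsC.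
  by rewrite ger0_norm ?subr_ge0 //; lra.
- apply/eqaddoP => e e0; apply: filterS2 (order_le e e0) good => m nd [[_ _ h1 h2 _] _].
  rewrite -[(_ - dR) m]/(#|(~: S m)%SET|%:R - dR m) (gtr0_norm (d0 m)).
  have h3 : dR m <= #|S m|%:R by rewrite ler_nat ltnW.
  have h4 : dR m <= #|(~: S m)%SET|%:R by rewrite ler_nat ltnW.
  have nE : n m = #|S m|%:R + #|(~: S m)%SET|%:R by rewrite -natrD cardsC.
  by rewrite ger0_norm ?subr_ge0 //; lra.
Qed.
End Asymptotics.

(** * Sharpness of the constant and conclusion *)

Lemma hub_graph_admissible (k : nat) : (0 < k)%N ->
  admissible k (hub_graph k) (fun a => (hub_size k a).-2).
Proof.
move=> k0; split; last first.
  by move=> m; split; [exact: hub_graph_connected|exact: hub_graph_regular|exact: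
    hub_graph_edge_connectivity].
apply/cvgnyPge => A; exists A => // m /= Am.
by apply: leq_trans Am _; rewrite /hub_size; nia.
Qed.

Lemma hub_size_littleo (R : realType) (k : nat) : (0 < k)%N ->
  (fun a => (hub_size k a)%:R : R) =
  (fun a => (hub_size k a).-2%:R : R) +o_\oo (fun a => (hub_size k a).-2%:R : R).
Proof.
move=> k0; apply/eqaddoP => e e0.
have [dinf _] := hub_graph_admissible k0.
have := cvg_comp _ _ dinf (@cvgr_idn R) => /cvgryPge /(_ (2 / e)).
apply: filterS => m /=; rewrite -[(_ - _) m]/((hub_size k m)%:R - (hub_size k m).-2%:R).
have h : (2 <= hub_size k m)%N by rewrite /hub_size; nia.
have -> : (hub_size k m)%:R = (hub_size k m).-2%:R + 2 :> R
  by rewrite -natrD -[in LHS](subnK h) subn2.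
rewrite addrAC subrr add0r ler_pdivrMr // => he.
by rewrite !ger0_norm // mulrC.
Qed.

Theorem theorem1p6 (R : realType) (k : nat) (hk : (0 < k)%N) :
  [/\ forall (G : nat -> sgraph) (d : nat -> nat), admissible k G d ->
        (((8 * k)%:R : R)%:E <= limn_einf (EFin \o scaled_gap R G d))%E,
      forall c : R, (8 * k)%:R < c ->
        exists (G : nat -> sgraph) (d : nat -> nat),
          admissible k G d /\ (limn_einf (EFin \o scaled_gap R G d) < c%:E)%E
    & forall (G : nat -> sgraph) (d : nat -> nat), admissible k G d ->
        (scaled_gap R G d @ \oo --> ((8 * k)%:R : R)) <->
        exists S : forall m, {set G m},
          [/\ \forall m \near \oo,
                proper_vertex_set (S m) /\ #|edge_cut (S m)| = k,
              (fun m => #|S m|%:R : R) =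
                (fun m => (d m)%:R : R) +o_\oo (fun m => (d m)%:R : R)
            & (fun m => #|(~: S m)%SET|%:R : R) =
                (fun m => (d m)%:R : R) +o_\oo (fun m => (d m)%:R : R)]].
Proof.
split=> [G d adm|c kc|G d adm].
- apply: (le_limn_einf (@scaled_gap_ge R k G d hk adm)).
  exact: (@cvg_gap_lower_bound R k G d hk adm).
- have adm := hub_graph_admissible hk.
  exists (hub_graph k), (fun a => (hub_size k a).-2); split=> //.
  (* Each side has only two vertices more than the degree, so the sequence converges to 8k itself,
     below every admissible [c]. *)
  have XC : scaled_gap R (hub_graph k) (fun a =>
    (hub_size k a).-2) @ \oo --> ((8 * k)%:R : R).
    apply: (scaled_gap_cvg_of_cut hk adm (S := hub_block k)).
    + by apply: nearW => m; split; [exact: hub_block_proper|exact: card_hub_cut].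
    + by under eq_fun do rewrite card_hub_block; exact: hub_size_littleo.
    + by under eq_fun do rewrite card_hub_blockC; exact: hub_size_littleo.
  have XC' : (EFin \o scaled_gap R (hub_graph k) (fun a =>
    (hub_size k a).-2)) @ \oo --> ((8 * k)%:R : R)%:E.
    by apply: cvg_EFin => //; apply: nearW.
  by rewrite (cvg_limn_einf_sup XC').1 lte_fin.
- split=> [|[S [cutS oS oSC]]]; first exact: cut_of_scaled_gap_cvg.
  exact: scaled_gap_cvg_of_cut cutS oS oSC.
Qed.
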